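(* Let $f:A\to B$ be a ring homomorphism, where $A$ is a Noetherian local ring with maximal ideal $M$, and let $J$ be an ideal of $B$ that is contained in the Jacobson radical of $B$ and is finitely generated as an $A$-module (via $f$). If $A$ is a Cohen-Macaulay ring having a canonical module isomorphic (as an $A$-module) to $J$, then $A\bowtie^f J$ is Gorenstein.
   Context: All rings are commutative with unity. $A\bowtie^f J:=\{(a,f(a)+j)\mid a\in A,\ j\in J\}$ is a subring of $A\times B$; under the hypotheses on $A$ and $J$ it is a Noetherian local ring. *)

(* Defs.v *)
From HB Require Import structures.
From mathcomp Require Import all_boot all_algebra.
From mathcomp Require Import boolp classical_sets.

Set Implicit Arguments.
Unset Strict Implicit.
Unset Printing Implicit Defensive.

Import GRing.Theory.
Local Open Scope classical_set_scope.
Local Open Scope ring_scope.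

Section Ideals.
Variable R : comPzRingType.

Definition is_ideal (I : set R) : Prop :=
  [/\ I 0, forall x y, I x -> I y -> I (x + y)
         & forall a x, I x -> I (a * x)].

(* Improper ideals are allowed, and membership need not be decidable, unlike
   for the ideals of ring_quotient. *)
Record ideal := Ideal { ideal_set :> set R; ideal_setP : is_ideal ideal_set }.

Definition prime_ideal (P : set R) : Prop :=
  [/\ is_ideal P, ~ P 1 & forall x y, P (x * y) -> P x \/ P y].

Definition maximal_ideal (N : set R) : Prop :=
  [/\ is_ideal N, ~ N 1
    & forall I : set R, is_ideal I -> N `<=` I -> I = N \/ I = setT].

Definition jacobson_radical : set R :=
  \bigcap_(N in [set N : set R | maximal_ideal N]) N.

Definition noetherian : Prop :=
  forall I : set R, is_ideal I ->
    exists (n : nat) (g : 'I_n -> R),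
      I = [set x | exists c : 'I_n -> R, x = \sum_(i < n) c i * g i].

Definition local_with_maximal_ideal (m : set R) : Prop :=
  maximal_ideal m /\ forall N, maximal_ideal N -> N = m.

Definition prime_chain_over (I : set R) (n : nat) (p : nat -> set R) : Prop :=
  (forall i, (i <= n)%N -> prime_ideal (p i) /\ I `<=` p i) /\
  (forall i, (i < n)%N -> p i `<` p i.+1).

(* dim (R / I) = d, the primes of R / I being the primes of R that contain I.
   Chains of length n have n.+1 members. *)
Definition quotient_krull_dim (I : set R) (d : nat) : Prop :=
  (exists p, prime_chain_over I d p) /\
  (forall n p, prime_chain_over I n p -> (n <= d)%N).

Definition krull_dim (d : nat) : Prop := quotient_krull_dim [set 0] d.

End Ideals.

Arguments noetherian : clear implicits.
Arguments jacobson_radical : clear implicits.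
Arguments krull_dim : clear implicits.

Section Modules.
Variable R : comPzRingType.

Definition fin_gen (M : lmodType R) : Prop :=
  exists (n : nat) (g : 'I_n -> M),
    forall x : M, exists c : 'I_n -> R, x = \sum_(i < n) c i *: g i.

Definition lmod_isomorphic (M N : lmodType R) : Prop :=
  exists g : {linear M -> N}, bijective g.

Definition annihilator (M : lmodType R) : set R :=
  [set a | forall x : M, a *: x = 0].

Definition module_dim (M : lmodType R) (d : nat) : Prop :=
  quotient_krull_dim (annihilator M) d.

(* The submodule (s_0, ..., s_(k-1)) M of M. *)
Definition seq_submodule (M : lmodType R) (s : seq R) : set M :=
  [set x | exists v : 'I_(size s) -> M, x = \sum_(i < size s) s`_i *: v i].
Arguments seq_submodule M s : clear implicits.

Definition regular_sequence (M : lmodType R) (s : seq R) : Prop :=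
  (forall i, (i < size s)%N -> forall x : M,
     seq_submodule M (take i s) (s`_i *: x) -> seq_submodule M (take i s) x) /\
  seq_submodule M s <> setT.

(* Numerical invariants are relations, e.g. depth m M t says that depth M = t. *)
Definition depth (m : set R) (M : lmodType R) (t : nat) : Prop :=
  (exists s : seq R,
     [/\ size s = t, (forall x, x \in s -> m x) & regular_sequence M s]) /\
  (forall s : seq R, (forall x, x \in s -> m x) -> regular_sequence M s ->
     (size s <= t)%N).

Definition injective_module (E : lmodType R) : Prop :=
  forall (X Y : lmodType R) (i : {linear X -> Y}) (g : {linear X -> E}),
    injective i -> exists h : {linear Y -> E}, forall x, h (i x) = g x.

(* An exact sequence 0 -> M -> E^0 -> E^1 -> ... with all E^n injective. *)
Record injective_resolution (M : lmodType R) := InjectiveResolution {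
  res_mod : nat -> lmodType R;
  res_diff : forall n, {linear res_mod n -> res_mod n.+1};
  res_aug : {linear M -> res_mod 0%N};
  res_injective : forall n, injective_module (res_mod n);
  res_aug_inj : injective res_aug;
  res_exact0 : forall x, res_diff 0%N x = 0 <-> exists y, x = res_aug y;
  res_exactS : forall n x,
    res_diff n.+1 x = 0 <-> exists y, x = res_diff n y
}.

Definition finite_injective_dim (M : lmodType R) : Prop :=
  exists (E : injective_resolution M) (n : nat),
    forall i, (n < i)%N -> forall x : res_mod E i, x = 0.

Section Ext.
Variables (N M : lmodType R) (E : injective_resolution M).

(* Ext^n(N, M) is the n-th cohomology of the complex Hom(N, E). *)
Definition ext_cocycle (n : nat) (g : N -> res_mod E n) : Prop :=
  linear g /\ forall x, res_diff E n (g x) = 0.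

Definition ext_coboundary (n : nat) : (N -> res_mod E n) -> Prop :=
  match n with
  | 0%N => fun g => forall x, g x = 0
  | n'.+1 => fun g =>
      exists h : {linear N -> res_mod E n'}, forall x, g x = res_diff E n' (h x)
  end.

End Ext.

(* k is (isomorphic to) the R-module R / m. *)
Definition residue_module (m : set R) (k : lmodType R) : Prop :=
  exists p : {linear R^o -> k},
    (forall y, exists x, y = p x) /\ (forall x, p x = 0 <-> m x).

(* The (R / m)-vector space Ext^n(R / m, M) has dimension r: the classes of
   the e j form a basis of it.  The scalars of R / m are represented by
   elements of R, so that independence is modulo m. *)
Definition ext_residue_dim (m : set R) (M : lmodType R) (n r : nat) : Prop :=
  exists k : lmodType R, residue_module m k /\
  exists (E : injective_resolution M) (e : 'I_r -> k -> res_mod E n),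
    [/\ forall j, ext_cocycle (e j),
        forall g : k -> res_mod E n, ext_cocycle g ->
          exists a : 'I_r -> R,
            ext_coboundary (fun x => g x - \sum_(j < r) a j *: e j x)
      & forall a : 'I_r -> R,
          ext_coboundary (fun x => \sum_(j < r) a j *: e j x) ->
          forall j, m (a j)].

Definition module_type (m : set R) (M : lmodType R) (r : nat) : Prop :=
  exists t, depth m M t /\ ext_residue_dim m M t r.

(* As in Bruns and Herzog, Cohen-Macaulay Rings; R is meant to be Noetherian
   local with maximal ideal m. *)

Definition cohen_macaulay_module (m : set R) (M : lmodType R) : Prop :=
  [/\ fin_gen M, (exists x : M, x <> 0)
    & exists d, depth m M d /\ module_dim M d].

Definition maximal_cohen_macaulay_module (m : set R) (M : lmodType R) : Prop :=
  cohen_macaulay_module m M /\ exists d, module_dim M d /\ krull_dim R d.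

Definition cohen_macaulay_ring (m : set R) : Prop :=
  cohen_macaulay_module m (R^o : lmodType R).

Definition canonical_module (m : set R) (C : lmodType R) : Prop :=
  [/\ maximal_cohen_macaulay_module m C, module_type m C 1
    & finite_injective_dim C].

End Modules.

Arguments seq_submodule {R} M s.

Definition gorenstein_local_ring (R : comPzRingType) : Prop :=
  [/\ noetherian R, (exists m : set R, local_with_maximal_ideal m)
    & finite_injective_dim (R^o : lmodType R)].

Definition ideal_pred (B : comPzRingType) (J : ideal B) : {pred B} :=
  fun b => b \in (J : set B).

Fact ideal_pred_zmod (B : comPzRingType) (J : ideal B) :
  zmod_closed (ideal_pred J).
Proof.
case: (ideal_setP J) => J0 JD JM; split; first exact/mem_set.
move=> x y /set_mem Jx /set_mem Jy; apply/mem_set/JD => //.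
by rewrite -mulN1r; apply: JM.
Qed.

HB.instance Definition _ (B : comPzRingType) (J : ideal B) :=
  GRing.isZmodClosed.Build B (ideal_pred J) (ideal_pred_zmod J).

(* The ideal J of B, as an A-module via f; the parameter f only serves to
   determine the scaling. *)
Record ideal_via (A B : comPzRingType) (f : {rmorphism A -> B}) (J : ideal B) :
  predArgType := IdealVia { ideal_val : B; _ : ideal_val \in ideal_pred J }.

Section IdealVia.
Variables (A B : comPzRingType) (f : {rmorphism A -> B}) (J : ideal B).
Local Notation JA := (ideal_via f J).

HB.instance Definition _ := [isSub for @ideal_val A B f J].
HB.instance Definition _ := [Choice of JA by <:].
HB.instance Definition _ := [SubChoice_isSubZmodule of JA by <:].

Fact ideal_scale_subproof (a : A) (x : JA) : f a * val x \in ideal_pred J.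
Proof.
case: (ideal_setP J) => _ _ JM.
by apply/mem_set/JM; apply: set_mem; exact: (valP x).
Qed.

Definition ideal_scale (a : A) (x : JA) : JA :=
  Sub (f a * val x) (ideal_scale_subproof a x).

Fact ideal_scaleA a b x : ideal_scale a (ideal_scale b x) = ideal_scale (a * b) x.
Proof. by apply: val_inj; rewrite /= rmorphM mulrA. Qed.

Fact ideal_scale1 : left_id 1 ideal_scale.
Proof. by move=> x; apply: val_inj; rewrite /= rmorph1 mul1r. Qed.

Fact ideal_scaleDr : right_distributive ideal_scale +%R.
Proof. by move=> a x y; apply: val_inj; rewrite /= mulrDr. Qed.

Fact ideal_scaleDl x : {morph ideal_scale^~ x : a b / a + b}.
Proof. by move=> a b; apply: val_inj; rewrite /= rmorphD mulrDl. Qed.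

HB.instance Definition _ := GRing.Zmodule_isLmodule.Build A JA
  ideal_scaleA ideal_scale1 ideal_scaleDr ideal_scaleDl.

Lemma ideal_val_scale a (x : JA) : val (a *: x) = f a * val x.
Proof. by []. Qed.

(* The amalgamation of A with B along J with respect to f, as a subring of the
   product ring A * B. *)
Definition amalg_set : set (A * B) :=
  [set x | exists a j, (J : set B) j /\ x = (a, f a + j)].

Definition amalg_pred : {pred A * B} := fun x => x \in amalg_set.

Fact amalg_subring : subring_closed amalg_pred.
Proof.
case: (ideal_setP J) => J0 JD JM; split.
- by apply/mem_set; exists 1, 0; split=> //; rewrite rmorph1 addr0.
- move=> _ _ /set_mem[a [j [Jj ->]]] /set_mem[b [k [Jk ->]]]; apply/mem_set.
  exists (a - b), (j - k); split; first by apply: JD; rewrite // -mulN1r; apply: JM.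
  by congr pair; rewrite /= rmorphB opprD addrACA.
- move=> _ _ /set_mem[a [j [Jj ->]]] /set_mem[b [k [Jk ->]]]; apply/mem_set.
  exists (a * b), (f a * k + (f b + k) * j); split.
    by apply: JD; apply: JM.
  by congr pair; rewrite /= rmorphM mulrDl mulrDr addrA [j * _]mulrC.
Qed.

HB.instance Definition _ :=
  GRing.isSubringClosed.Build (A * B)%type amalg_pred amalg_subring.

Record amalgamation : predArgType :=
  Amalgamation { amalg_val : A * B; _ : amalg_val \in amalg_pred }.

HB.instance Definition _ := [isSub for amalg_val].
HB.instance Definition _ := [Choice of amalgamation by <:].
HB.instance Definition _ := GRing.SubChoice_isSubComPzRing.Build _ _ amalgamation
  (GRing.subringClosedP _).

End IdealVia.

(* Main.v *)
Require Import Defs.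
From HB Require Import structures.
From mathcomp Require Import all_boot all_algebra generic_quotient ring_quotient.
From mathcomp Require Import boolp classical_sets functions.
Set Implicit Arguments.
Unset Strict Implicit.
Unset Printing Implicit Defensive.
Import GRing.Theory.
Local Open Scope classical_set_scope.
Local Open Scope ring_scope.

(** The ring [R] = [amalgamation f J] is [A + J] as an [A]-module, hence finite over
    [A]; let [pi] : [R -> J] be the [A]-linear projection.  The map
    [r |-> (s |-> pi (s * r))] from [R] to Hom_A(R, J) is an isomorphism as soon as
    [A -> End_A(J)] is one ([self_duality]).  Applying Hom_A(R, -) to a finite
    injective resolution of [J] over [A] yields injective [R]-modules
    ([coind_injective]), and the resulting complex is exact in positive degrees
    when Ext^i_A(A + J, J) = 0 for i > 0; it is then a finite injective resolution
    of [R] ([gorenstein_resolution]).  So the theorem rests on two properties of a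
    canonical module [C]: every endomorphism of [C] is multiplication by a unique
    scalar, and Ext^i_A(C, C) = 0 for i > 0 ([canonical_homothety]).

    Both are proved by induction on the depth n of [A], which is also the dimension
    of [A] and the depth of [C] ([canonical_core]).  Rings [A / I] do not appear as
    types: one works with the [A]-modules killed by [I] and with the modules that
    are injective among those.  Let x in M be regular on [A / I] and on [C].  If
    [E] is a resolution of [C] by such injectives, the elements of [E] killed by x,
    with the split summand E^0[x] removed, form a resolution of [C / xC] over
    [I + xA], shifted by one degree ([compress]); so finite injective dimension and
    type one are inherited.  The conclusions are lifted back from [C / xC] to [C] by
    Nakayama's lemma ([step_homothety_iso], [step_self_acyclic]), which for
    Ext^i(C, C) requires finite generation ([ext_noeth]).  Prime avoidance provides a
    common x ([common_reg]), and regular sequences may be started at any regular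
    element ([reg_seq_exchange]), so the depths of [A / I] and [C] drop together.

    When n = 0, the only prime over [I] is M, so every proper ideal J over [I] has
    an element s outside it with Ms in J.  Devissage along such elements, starting
    from the top of the finite resolution, gives Ext^i(A / J, C) = 0 for i > 0
    ([zero_dim_acyclic]); this makes [C] behave as the injective hull of [A / M],
    and a direct form of Matlis duality determines End(C) ([zero_dim_end]). *)

(** * Linear maps *)

Section LinearMaps.
Variables (A : comPzRingType) (U V : lmodType A).

Definition lin_of (g : U -> V) (gL : linear g) : {linear U -> V} :=
  let gm := GRing.isLinear.Build A U V *:%R g gL in HB.pack g gm.

Lemma lin_ofE (g : U -> V) (gL : linear g) x : lin_of gL x = g x.
Proof. by []. Qed.

(** Lets a linear map be given by a property of its values, without choosing the
    values linearly: closure under combinations and the condition at 0 make the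
    relation single-valued. *)
Lemma lin_of_rel (G : U -> V -> Prop) :
  (forall x, exists y, G x y) ->
  (forall a x y x' y', G x y -> G x' y' -> G (a *: x + x') (a *: y + y')) ->
  (forall y, G 0 y -> y = 0) ->
  exists h : {linear U -> V}, forall x, G x (h x).
Proof.
move=> Gtot GD G0.
have [h hP] := choice Gtot.
suff hL : linear h by exists (lin_of hL).
move=> a x y; apply/subr0_eq/G0.
have := GD (-1) _ _ _ _ (GD a _ _ _ _ (hP x) (hP y)) (hP (a *: x + y)).
by rewrite !scaleN1r addNr [- _ + h _]addrC.
Qed.

End LinearMaps.

Section Maps.
Variable A : comPzRingType.

Definition lcomp (U V W : lmodType A) (g : {linear V -> W}) (f : {linear U -> V}) :
  {linear U -> W} := g \o f.

Lemma lcompE (U V W : lmodType A) (g : {linear V -> W}) (f : {linear U -> V}) u :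
  lcomp g f u = g (f u).
Proof. by []. Qed.

Fact line_linear (V : lmodType A) (v : V) : linear (fun a : A^o => a *: v).
Proof. by move=> a b c; rewrite scalerDl -scalerA. Qed.
Definition line (V : lmodType A) (v : V) : {linear A^o -> V} := lin_of (line_linear v).

End Maps.

Section LinearCombination.
Variables (A : comPzRingType) (U V : lmodType A).

Fact lin_comb_linear (a : A) (g h : {linear U -> V}) : linear (fun u => a *: g u + h u).
Proof.
by move=> b u v; rewrite (linearP g) (linearP h) !scalerDr !scalerA mulrC addrACA.
Qed.
Definition lin_comb a g h : {linear U -> V} := lin_of (lin_comb_linear a g h).

Lemma lin_combE a g h u : lin_comb a g h u = a *: g u + h u. Proof. by []. Qed.

End LinearCombination.

(** * Submodules and quotient modules *)

Section Submodules.
Variable A : comPzRingType.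
Implicit Types V : lmodType A.

Definition submod V (P : set V) : Prop :=
  [/\ P 0, forall x y, P x -> P y -> P (x + y) & forall a x, P x -> P (a *: x)].

Record submodule V := Submodule { sm_set : V -> Prop; sm_P : submod sm_set }.
Coercion sm_set : submodule >-> Funclass.

Section Closure.
Variables (V : lmodType A) (P : set V) (hP : submod P).
Lemma sm0 : P 0. Proof. by case: hP. Qed.
Lemma smD x y : P x -> P y -> P (x + y). Proof. by case: hP => _ + _; apply. Qed.
Lemma smZ a x : P x -> P (a *: x). Proof. by case: hP => _ _; apply. Qed.
Lemma smN x : P x -> P (- x).
Proof. by move=> Px; rewrite -scaleN1r; apply: smZ. Qed.
Lemma smB x y : P x -> P y -> P (x - y).
Proof. by move=> Px Py; apply: smD => //; apply: smN. Qed.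
Lemma smD_l x y : P y -> P (x + y) -> P x.
Proof. by move=> Py Pxy; rewrite -(addrK y x); apply: smB. Qed.
Lemma smD_r x y : P x -> P (x + y) -> P y.
Proof. by move=> Px; rewrite addrC; apply: smD_l. Qed.
End Closure.

Section SubType.
Variables (V : lmodType A) (P : submodule V).

Definition sm_pred : {pred V} := fun v => `[< P v >].

Fact sm_pred_closed : submod_closed sm_pred.
Proof.
split; first exact/asboolP/(sm0 (sm_P P)).
move=> a u v /asboolP Pu /asboolP Pv.
exact/asboolP/(smD (sm_P P))/Pv/(smZ (sm_P P)).
Qed.

HB.instance Definition _ := GRing.isSubmodClosed.Build A V sm_pred sm_pred_closed.

Record sm_type := SmType { sm_val : V; _ : sm_val \in sm_pred }.

HB.instance Definition _ := [isSub for sm_val].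
HB.instance Definition _ := [Choice of sm_type by <:].
HB.instance Definition _ := [SubChoice_isSubLmodule of sm_type by <:].

Definition sm_in (v : V) (Pv : P v) : sm_type := SmType (asboolT Pv).

Lemma sm_valP (u : sm_type) : P (sm_val u).
Proof. by case: u => v /= /asboolP. Qed.

Lemma sm_val_inj : injective sm_val. Proof. exact: val_inj. Qed.

Lemma sm_val_linear : linear sm_val.
Proof. by move=> a u v. Qed.

Definition sm_lin : {linear sm_type -> V} := lin_of sm_val_linear.

Lemma sm_corestr (U : lmodType A) (g : {linear U -> V}) (gP : forall u, P (g u)) :
  exists h : {linear U -> sm_type}, forall u, sm_val (h u) = g u.
Proof.
have hL : linear (fun u => sm_in (gP u)).
  by move=> a u v; apply: sm_val_inj; rewrite /= linearP.
by exists (lin_of hL).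
Qed.

End SubType.

Section Quotient.
Variables (V : lmodType A) (P : submodule V).
Local Open Scope quotient_scope.

Definition quo := Quotient.quot (sm_pred P).
HB.instance Definition _ := GRing.Zmodule.on quo.
HB.instance Definition _ := EqQuotient.on quo.

Definition qpi (v : V) : quo := \pi_quo v.

Lemma qpi_eq u v : (qpi u = qpi v) <-> P (u - v).
Proof.
have := @Quotient.idealrBE V (sm_pred P) u v; rewrite unfold_in => PE.
by split=> [/eqP|] h; [apply/asboolP; rewrite PE | apply/eqP; rewrite -PE; apply/asboolP].
Qed.

Lemma qpi_surj (q : quo) : exists v, q = qpi v.
Proof. by exists (repr q); rewrite /qpi reprK. Qed.

Fact qpi_D u v : qpi (u + v) = qpi u + qpi v.
Proof. exact: (raddfD \pi_quo). Qed.

Definition qscale (a : A) (q : quo) : quo := qpi (a *: repr q).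

Lemma qscaleE a v : qscale a (qpi v) = qpi (a *: v).
Proof.
apply/qpi_eq; rewrite -scalerBr; apply: (smZ (sm_P P)).
by apply/qpi_eq; rewrite /qpi reprK.
Qed.

Fact qscaleA a b q : qscale a (qscale b q) = qscale (a * b) q.
Proof. by have [v ->] := qpi_surj q; rewrite !qscaleE scalerA. Qed.
Fact qscale1 : left_id 1 qscale.
Proof. by move=> q; have [v ->] := qpi_surj q; rewrite !qscaleE scale1r. Qed.
Fact qscaleDr : right_distributive qscale +%R.
Proof.
move=> a p q; have [u ->] := qpi_surj p; have [v ->] := qpi_surj q.
by rewrite -qpi_D !qscaleE scalerDr qpi_D.
Qed.
Fact qscaleDl q : {morph qscale^~ q : a b / a + b}.
Proof. by move=> a b; have [v ->] := qpi_surj q; rewrite !qscaleE scalerDl qpi_D. Qed.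

HB.instance Definition _ := GRing.Zmodule_isLmodule.Build A quo
  qscaleA qscale1 qscaleDr qscaleDl.

Lemma qpi_linear : linear qpi.
Proof. by move=> a u v; rewrite qpi_D -qscaleE. Qed.

Definition qlin : {linear V -> quo} := lin_of qpi_linear.

Lemma qlin_surj q : exists v, q = qlin v. Proof. exact: qpi_surj. Qed.

Lemma qlin_eq0 v : (qlin v = 0) <-> P v.
Proof.
split=> [h|h].
  by rewrite -[v]subr0; apply/qpi_eq; rewrite -[LHS]/(qlin v) h -[RHS]/(qlin 0) linear0.
by rewrite -(linear0 qlin); apply/qpi_eq; rewrite subr0.
Qed.

Lemma quo_lift (W : lmodType A) (g : {linear V -> W}) :
  (forall v, P v -> g v = 0) -> exists h : {linear quo -> W}, forall v, h (qlin v) = g v.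
Proof.
move=> gP.
have [||y [v [/esym/qlin_eq0 Pv ->]]|h hP] :=
    @lin_of_rel A quo W (fun q w => exists v, q = qlin v /\ w = g v).
- by move=> q; have [v qv] := qlin_surj q; exists (g v), v.
- move=> a x _ x' _ [v [-> ->]] [v' [-> ->]].
  by exists (a *: v + v'); rewrite !linearP.
- exact: gP.
exists h => v; have [v' [vv' ->]] := hP (qlin v).
by apply/subr0_eq; rewrite -linearB; apply: gP; apply/qpi_eq.
Qed.

End Quotient.
End Submodules.

Arguments sm0 {A V P} hP.
Arguments smD {A V P} hP {x y}.
Arguments smZ {A V P} hP a {x}.
Arguments smN {A V P} hP {x}.
Arguments smB {A V P} hP {x y}.
Arguments smD_l {A V P} hP {x y}.
Arguments smD_r {A V P} hP {x y}.
Arguments qlin {A V} P : simpl never.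

(** * Noetherian modules and Nakayama's lemma *)

Section Generation.
Variables (A : comPzRingType) (V : lmodType A).
Implicit Types (B Z S : set V) (s : seq V).

(** The submodule generated by [s] over [B].  Keeping [B] as a parameter gives
    statements about a subquotient without forming it. *)
Fixpoint gen s B : set V :=
  if s is g :: s' then [set x | exists a y, gen s' B y /\ x = a *: g + y] else B.

(** For submodules [B] and [Z], noetherianity of the image of [Z] modulo [B]. *)
Definition rel_noeth B Z := forall S, submod S -> S `<=` Z ->
  exists s, (forall g, g \in s -> S g) /\ S `<=` gen s B.

Lemma gen_submod s B : submod B -> submod (gen s B).
Proof.
move=> hB; elim: s => //= g s [h0 hD hZ]; split.
- by exists 0, 0; rewrite scale0r addr0.
- move=> _ _ [a [y [hy ->]]] [b [z [hz ->]]]; exists (a + b), (y + z).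
  by split; [exact: hD | rewrite scalerDl addrACA].
- move=> c _ [a [y [hy ->]]]; exists (c * a), (c *: y).
  by split; [exact: hZ | rewrite scalerDr scalerA].
Qed.

Lemma gen_base s B : B `<=` gen s B.
Proof.
elim: s => //= g s IH x Bx; exists 0, x; split; first exact: IH.
by rewrite scale0r add0r.
Qed.

Lemma gen_mem s B : submod B -> forall g, g \in s -> gen s B g.
Proof.
move=> hB; elim: s => //= h s IH g; rewrite in_cons => /orP[/eqP->|gs].
  by exists 1, 0; split; [exact: sm0 (gen_submod s hB) | rewrite scale1r addr0].
by exists 0, g; split; [exact: IH | rewrite scale0r add0r].
Qed.

Lemma gen_min s B S :
  submod S -> B `<=` S -> (forall g, g \in s -> S g) -> gen s B `<=` S.
Proof.
move=> hS BS; elim: s => //= g s IH sS _ [a [y [hy ->]]].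
apply: (smD hS); first by apply: (smZ hS); apply: sS; rewrite mem_head.
by apply: IH => // h hs; apply: sS; rewrite in_cons hs orbT.
Qed.

Lemma gen_mono s t B B' : submod B' -> B `<=` B' -> {subset s <= t} ->
  gen s B `<=` gen t B'.
Proof.
move=> hB' BB' st; apply: gen_min; first exact: gen_submod.
  by move=> x /BB'; apply: gen_base.
by move=> g /st; apply: gen_mem.
Qed.

Lemma submod0 : submod [set (0 : V)].
Proof.
split=> //= [x y -> ->|a x ->]; first exact: addr0.
exact: scaler0.
Qed.

Lemma rel_noethW B B' Z Z' : submod B' -> B `<=` B' -> Z' `<=` Z ->
  rel_noeth B Z -> rel_noeth B' Z'.
Proof.
move=> hB' BB' ZZ' N S hS SZ; have [s [sS Ss]] := N S hS (subset_trans SZ ZZ').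
by exists s; split=> // x /Ss; apply: gen_mono.
Qed.

Lemma gen_sumP n (g : 'I_n -> V) x :
  gen (codom g) [set 0] x <-> exists c : 'I_n -> A, x = \sum_(i < n) c i *: g i.
Proof.
split=> [|[c ->]]; last first.
  have hB := gen_submod (codom g) submod0.
  elim/big_ind: _ => [|u v|i _]; [exact: sm0 hB|move=> hu hv; exact: (smD hB hu hv)|].
  exact: (smZ hB _ (gen_mem submod0 (codom_f _ _))).
apply: (gen_min (S := [set x | exists c : 'I_n -> A, x = \sum_(i < n) c i *: g i])).
- split.
  + by exists (fun=> 0); rewrite big1 // => i _; rewrite scale0r.
  + move=> _ _ [c ->] [d ->]; exists (fun i => c i + d i).
    by rewrite -big_split; apply: eq_bigr => i _; rewrite scalerDl.
  + move=> a _ [c ->]; exists (fun i => a * c i).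
    by rewrite scaler_sumr; apply: eq_bigr => i _; rewrite scalerA.
- move=> _ ->; exists (fun=> 0); rewrite big1 // => i _; exact: scale0r.
- move=> _ /codomP[i ->]; exists (fun j => (j == i)%:R).
  rewrite (bigD1 i) //= eqxx scale1r big1 ?addr0 // => j /negbTE->.
  exact: scale0r.
Qed.

Lemma gen_fin_gen s : (forall x : V, gen s [set 0] x) -> fin_gen V.
Proof.
move=> h; exists (size s), (fun i => nth 0 s i) => x; apply/gen_sumP.
apply: gen_mono (h x) => //; first exact: submod0.
move=> g gs; apply/codomP.
have ig : (index g s < size s)%N by rewrite index_mem.
by exists (Ordinal ig); rewrite /= nth_index.
Qed.

Lemma fin_gen_gen : fin_gen V -> exists s, forall x : V, gen s [set 0] x.
Proof.
by move=> [n [g gP]]; exists (codom g) => x; apply/gen_sumP; exact: gP.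
Qed.

End Generation.

Arguments rel_noeth {A V}.
Definition noeth_mod (A : comPzRingType) (V : lmodType A) :=
  @rel_noeth A V [set 0] setT.

Section Noetherian.
Variable A : comPzRingType.
Hypothesis A_noeth : noetherian A.

Lemma noeth_regular : noeth_mod (A^o : lmodType A).
Proof.
move=> I hI _; have [//|n [g IE]] := A_noeth (I := I).
have gE (x : A^o) : gen (codom (g : 'I_n -> A^o)) [set 0] x <-> I x.
  by rewrite IE; exact: gen_sumP.
exists (codom (g : 'I_n -> A^o)); split=> [x xg|x /gE//].
by apply/gE; apply: gen_mem => //; exact: submod0.
Qed.

(** Adding a generator [g]: the coefficients of [g] in the elements of [S] form an
    ideal, and elements of [S] that realise generators of this ideal reduce the
    question to the part of [S] that avoids [g]. *)
Lemma noeth_gen (V : lmodType A) (s : seq V) (B : set V) :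
  submod B -> rel_noeth B (gen s B).
Proof.
move=> hB; elim: s => [|g s IH] S hS SZ.
  by exists [::]; split.
have hG := gen_submod s hB.
pose I : set A^o := [set a | exists x, S x /\ gen s B (x - a *: g)].
have hI : submod I.
  split.
  - by exists 0; rewrite scale0r subr0; split; [exact: sm0 hS|exact: sm0 hG].
  - move=> a b [x [Sx hx]] [y [Sy hy]]; exists (x + y); split.
      exact: (smD hS).
    by rewrite scalerDl opprD addrACA; apply: (smD hG).
  - move=> c a [x [Sx hx]]; exists (c *: x); split; first exact: (smZ hS _).
    by rewrite -[c *: a]/(c * a) -scalerA -scalerBr; apply: (smZ hG _).
have [t [tI It]] := noeth_regular hI (@subsetT _ I).
have [xs [xsS xsP]] : exists xs, (forall x, x \in xs -> S x) /\
    forall a, gen t [set 0] a ->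
      exists x, gen xs [set 0] x /\ gen s B (x - a *: g).
  elim: t tI {It} => [|b t IHt] tI.
    exists [::]; split=> // _ ->; exists 0; split=> //.
    by rewrite scale0r subr0; exact: sm0 hG.
  have [|xs [xsS xsP]] := IHt; first by move=> a at_; apply: tI; rewrite in_cons at_ orbT.
  have [x [Sx hx]] := tI b (mem_head _ _).
  exists (x :: xs); split.
    by move=> y; rewrite in_cons => /orP[/eqP->//|]; exact: xsS.
  move=> _ [c [d [/xsP[y [hy hyd]] ->]]]; exists (c *: x + y); split.
    by exists c, y.
  rewrite scalerDl opprD addrACA -[c *: b]/(c * b) -scalerA -scalerBr.
  by apply: (smD hG) => //; apply: (smZ hG _).
have [|t0 [t0S t0P]] := IH (S `&` gen s B) _ (@subIsetr _ _ _).
  split; first by split; [exact: sm0 hS|exact: sm0 hG].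
    by move=> x y [] + + [] *; split; [apply: (smD hS)|apply: (smD hG)].
  by move=> a x [] *; split; [apply: (smZ hS _)|apply: (smZ hG _)].
exists (xs ++ t0); split.
  by move=> x; rewrite mem_cat => /orP[/xsS//|/t0S[]].
move=> x Sx; have [a [y [hy xE]]] := SZ x Sx.
have /It/xsP[z [hz hza]] : I a.
  by exists x; split=> //; rewrite xE addrC addKr.
have Sz : S z by apply: gen_min hz => // _ ->; exact: sm0 hS.
rewrite -(subrK z x); have hX := gen_submod (xs ++ t0) hB.
apply: (smD hX); last first.
  apply: gen_mono hz => // [_ ->|w]; first exact: sm0 hB.
  by rewrite mem_cat => ->.
apply: (gen_mono hB (@subset_refl _ B)); last apply: t0P.
  by move=> w; rewrite mem_cat orbC => ->.
split; first exact: (smB hS).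
have -> : x - z = y - (z - a *: g) by rewrite xE opprB addrA [y + _]addrC.
exact: (smB hG).
Qed.

Lemma fin_gen_noeth (V : lmodType A) : fin_gen V -> noeth_mod V.
Proof.
move=> /fin_gen_gen[s sP].
apply: (rel_noethW (@submod0 A V) (@subset_refl _ _) _ (noeth_gen (s := s) (@submod0 A V))).
by move=> x _; exact: sP.
Qed.

End Noetherian.

Section Maximal.
Variables (A : comPzRingType) (V : lmodType A).
Hypothesis V_noeth : noeth_mod V.

(** Otherwise a strictly increasing sequence of members of [F] is obtained by
    choice; its union is finitely generated, hence equal to one of its terms. *)
Lemma noeth_max (F : set (set V)) (P0 : set V) :
  (forall P, F P -> submod P) -> F P0 ->
  exists P, [/\ F P, P0 `<=` P & forall Q, F Q -> P `<=` Q -> Q `<=` P].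
Proof.
move=> Fsub FP0; apply: contrapT => noP.
have nextP (P : set V) : exists Q, F P -> P0 `<=` P ->
    [/\ F Q, P `<=` Q & ~ Q `<=` P].
  have [[FP P0P]|nFP] := pselect (F P /\ P0 `<=` P); last first.
    by exists P => FP P0P; case: nFP.
  apply: contrapT => h; apply: noP; exists P; split=> // Q FQ PQ.
  by apply: contrapT => QP; apply: h; exists Q.
have [next nP] := choice nextP.
(* A strictly increasing sequence in F, followed by its union U. *)
pose c n := iter n next P0.
have cP n : F (c n) /\ P0 `<=` c n.
  elim: n => [|n [Fc Pc]]; first by split.
  have [FQ PQ _] := nP _ Fc Pc; split=> //; exact: subset_trans Pc PQ.
have cS n : c n `<=` c n.+1 by have [Fc Pc] := cP n; have [] := nP _ Fc Pc.
have cm m n : (m <= n)%N -> c m `<=` c n.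
  move=> /subnKC <-; elim: (n - m)%N => [|k IH]; first by rewrite addn0.
  by rewrite addnS; apply: subset_trans IH (cS _).
pose U : set V := [set x | exists n, c n x].
have hU : submod U.
  split; first by exists 0; exact: sm0 (Fsub _ (cP 0%N).1).
    move=> x y [m cx] [n cy]; exists (maxn m n); apply: (smD (Fsub _ (cP _).1)).
      exact: cm (leq_maxl _ _) _ cx.
    exact: cm (leq_maxr _ _) _ cy.
  by move=> a x [m cx]; exists m; apply: (smZ (Fsub _ (cP _).1) _).
have [s [sU Us]] := V_noeth hU (@subsetT _ U).
have [n sn] : exists n, forall g, g \in s -> c n g.
  elim: s sU {Us} => [|g s IH] sU; first by exists 0%N.
  have [|n nP'] := IH; first by move=> h hs; apply: sU; rewrite in_cons hs orbT.
  have [m cg] := sU g (mem_head _ _).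
  exists (maxn m n) => h; rewrite in_cons => /orP[/eqP->|/nP'].
    exact: cm (leq_maxl _ _) _ cg.
  exact: cm (leq_maxr _ _) _.
have [Fc Pc] := cP n; have [_ _] := nP _ Fc Pc; apply => x cx.
apply: (@gen_min _ _ s [set 0]) => //; first exact: Fsub.
  by move=> _ ->; exact: sm0 (Fsub _ Fc).
by apply: Us; exists n.+1.
Qed.

End Maximal.

Section Local.
Variables (A : comPzRingType) (M : set A).
Hypotheses (A_noeth : noetherian A) (A_local : local_with_maximal_ideal M).

Lemma M_ideal : submod (M : set A^o). Proof. by case: A_local => -[]. Qed.

Lemma M_proper : ~ M 1. Proof. by case: A_local => -[]. Qed.

Lemma proper_ideal_sub (I : set A^o) : submod I -> ~ I 1 -> I `<=` M.
Proof.
move=> hI I1.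
have [||P [[hP P1] IP maxP]] :=
  noeth_max (noeth_regular A_noeth) (F := fun P : set A^o => submod P /\ ~ P 1) (P0 := I).
- by move=> P [].
- by [].
suff <- : P = M by [].
case: A_local => _; apply; split=> // Q hQ PQ.
have [Q1|nQ1] := pselect (Q 1).
  by right; apply/seteqP; split=> // x _; rewrite -(mulr1 x); case: hQ => _ _; apply.
by left; apply/seteqP; split=> //; apply: maxP.
Qed.

Lemma unit_notM a : ~ M a -> exists b, b * a = 1.
Proof.
move=> Ma; apply: contrapT => nb; apply: Ma.
apply: (proper_ideal_sub (I := [set x | exists b, x = b * a])).
- split; first by exists 0; rewrite mul0r.
    by move=> _ _ [b ->] [c ->]; exists (b + c); rewrite mulrDl.
  by move=> d _ [b ->]; exists (d * b); rewrite -mulrA.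
- by move=> [b /esym h]; apply: nb; exists b.
- by exists 1; rewrite mul1r.
Qed.

Lemma unit_1M x : M x -> exists b, b * (1 - x) = 1.
Proof.
move=> Mx; apply: unit_notM => M1x; apply: M_proper.
by rewrite -(subrK x 1); apply: (smD M_ideal).
Qed.

(** Generators are removed one at a time: writing [g] as [x] times an element of
    [Z] gives [(1 - x * a) *: g] in the span of the other generators, and
    [1 - x * a] is invertible. *)
Lemma nakayama (V : lmodType A) (B Z : set V) x :
  submod B -> rel_noeth B Z -> submod Z -> M x ->
  (forall z, Z z -> exists2 z', Z z' & B (z - x *: z')) -> Z `<=` B.
Proof.
move=> hB N hZ Mx ZxZ; have [s [sZ Zs]] := N Z hZ (@subset_refl _ Z).
elim: s sZ Zs => [|g s IH] sZ Zs //.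
apply: IH => [h hs|z Zz]; first by apply: sZ; rewrite in_cons hs orbT.
have hG := gen_submod s hB.
suff gg : gen s B g.
  apply: (gen_min (s := g :: s) hG) (Zs z Zz); first exact: gen_base.
  by move=> h; rewrite in_cons => /orP[/eqP->//|]; apply: gen_mem.
have [z' Zz' Bz'] := ZxZ g (sZ g (mem_head _ _)).
have [a [y [hy z'E]]] := Zs z' Zz'.
have [b b1] := unit_1M (smZ M_ideal a (Mx : (M : set A^o) x)).
rewrite -[g]scale1r -b1 -scalerA; apply: (smZ hG _).
have -> : (1 - a *: (x : A^o)) *: g = (g - x *: z') + x *: y.
  rewrite z'E scalerDr scalerA opprD addrA subrK scalerBl scale1r.
  by rewrite -[a *: _]/(a * x) mulrC.
by apply: (smD hG); [exact: gen_base|apply: (smZ hG _)].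
Qed.

End Local.

(** * Regular elements, prime avoidance and regular sequences *)

Section ProductModule.
Variables (A : comPzRingType) (V W : lmodType A).

Definition fst_lin : {linear (V * W)%type -> V} := fst.
Definition snd_lin : {linear (V * W)%type -> W} := snd.

Lemma fin_gen_prod : fin_gen V -> fin_gen W -> fin_gen (V * W)%type.
Proof.
move=> /fin_gen_gen[s sP] /fin_gen_gen[t tP].
pose S := [seq (v, 0 : W) | v <- s] ++ [seq (0 : V, w) | w <- t].
apply: (@gen_fin_gen _ _ S) => -[x y].
have hG := gen_submod S (@submod0 A (V * W)%type).
have -> : (x, y) = (x, 0) + (0, y) by congr pair; rewrite /= ?addr0 ?add0r.
apply: (smD hG).
  apply: (@gen_min _ _ s [set 0] [set v | gen S [set 0] (v, 0)]) (sP x).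
  - split; first exact: (sm0 hG).
      move=> u v hu hv /=; have := smD hG hu hv; congr (gen _ _ _).
      by congr pair; rewrite /= addr0.
    move=> a u hu /=; have := smZ hG a hu; congr (gen _ _ _).
    by congr pair; rewrite /= scaler0.
  - by move=> _ ->; exact: (sm0 hG).
  - move=> g gs; apply: gen_mem; first exact: submod0.
    by rewrite mem_cat (map_f (fun v => (v, 0 : W))).
apply: (@gen_min _ _ t [set 0] [set w | gen S [set 0] (0, w)]) (tP y).
- split; first exact: (sm0 hG).
    move=> u v hu hv /=; have := smD hG hu hv; congr (gen _ _ _).
    by congr pair; rewrite /= addr0.
  move=> a u hu /=; have := smZ hG a hu; congr (gen _ _ _).
  by congr pair; rewrite /= scaler0.
- by move=> _ ->; exact: (sm0 hG).
- move=> g gs; apply: gen_mem; first exact: submod0.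
  by rewrite mem_cat orbC (map_f (fun w => (0 : V, w))).
Qed.

End ProductModule.

Section Regular.
Variables (A : comPzRingType) (M : set A).

Section Modulo.
Variable V : lmodType A.
Implicit Type P : set V.

(** Regularity of [x] on [V / P].  Quotients are encoded by submodules of one fixed
    module, so that dividing by two elements in either order gives equal results. *)
Definition reg_mod x P := forall v, P (x *: v) -> P v.
(** The submodule P + xV. *)
Definition add_mult P x : set V := [set v | exists p w, P p /\ v = p + x *: w].
(** [V / P] has a regular sequence of length [n] in [M]; the last quotient may
    vanish, which Nakayama's lemma excludes when [V / P] is nonzero and finitely
    generated. *)
Fixpoint has_reg_seq n P : Prop :=
  if n is n'.+1 then exists x, [/\ M x, reg_mod x P & has_reg_seq n' (add_mult P x)] else True.
Definition no_socle P := forall v, (forall m, M m -> P (m *: v)) -> P v.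
Definition ann P v : set A^o := [set a | P (a *: v)].
(** The ideals [ann P v] for such [v] are the maximal elements among the annihilators
    of nonzero elements of [V / P]; they are associated primes. *)
Definition max_ann P v :=
  ~ P v /\ forall w, ~ P w -> ann P v `<=` ann P w -> ann P w `<=` ann P v.

Lemma add_mult_submod P x : submod P -> submod (add_mult P x).
Proof.
move=> hP; split.
- by exists 0, 0; rewrite scaler0 addr0; split=> //; exact: (sm0 hP).
- move=> _ _ [p [w [hp ->]]] [q [z [hq ->]]]; exists (p + q), (w + z).
  by split; [exact: (smD hP)|rewrite scalerDr addrACA].
- move=> a _ [p [w [hp ->]]]; exists (a *: p), (a *: w).
  by split; [exact: (smZ hP)|rewrite scalerDr !scalerA mulrC].
Qed.

Lemma add_mult_sub P x : P `<=` add_mult P x.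
Proof. by move=> v Pv; exists v, 0; rewrite scaler0 addr0. Qed.

Lemma add_mult_mul P x v : submod P -> add_mult P x (x *: v).
Proof. by move=> hP; exists 0, v; rewrite add0r; split=> //; exact: (sm0 hP). Qed.

Lemma add_multAC P x y : add_mult (add_mult P x) y = add_mult (add_mult P y) x.
Proof.
apply/seteqP; split=> _ [_ [w [[p [z [hp ->]]] ->]]].
  by exists (p + y *: w), z; split; [exists p, w|rewrite addrAC].
by exists (p + x *: w), z; split; [exists p, w|rewrite addrAC].
Qed.

Lemma ann_submod P v : submod P -> submod (ann P v).
Proof.
move=> hP; split; rewrite /ann /=.
- by rewrite scale0r; exact: (sm0 hP).
- by move=> a b ha hb; rewrite scalerDl; exact: (smD hP).
- by move=> a b hb; rewrite -[a *: b]/(a * b) -scalerA; exact: (smZ hP).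
Qed.

Lemma reg_no_socle x P : M x -> reg_mod x P -> no_socle P.
Proof. by move=> Mx rx v h; apply: rx; apply: h. Qed.

Lemma max_ann_prime P v : submod P -> max_ann P v ->
  forall a b, ann P v (a * b) -> ann P v a \/ ann P v b.
Proof.
move=> hP [Pv maxv] a b; rewrite /ann /= => hab.
have [|na] := pselect (P (a *: v)); first by left.
right; apply: (maxv _ na) => [c|]; rewrite /ann /= scalerA; last by rewrite mulrC.
by move=> hc; rewrite mulrC -scalerA; exact: (smZ hP).
Qed.

(** A prime that contains none of the ideals [ann P u] does not contain their
    product. *)
Lemma prod_ann P v (L : seq V) : submod P -> max_ann P v ->
  (forall u, u \in L -> ~ ann P u `<=` ann P v) ->
  exists b, ~ ann P v b /\ forall u, u \in L -> ann P u b.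
Proof.
move=> hP mv; elim: L => [|u L IH] hL.
  by exists 1; split=> //; rewrite /ann /= scale1r; case: mv.
have [|b [nb bL]] := IH; first by move=> w wL; apply: hL; rewrite in_cons wL orbT.
have [c uc nc] : exists2 c, ann P u c & ~ ann P v c.
  apply: contrapT => h; apply: (hL u (mem_head _ _)) => c hc.
  by apply: contrapT => nc; apply: h; exists c.
exists (c * b); split; first by move=> /(max_ann_prime hP mv)[].
move=> w; rewrite in_cons => /orP[/eqP->|wL].
  by rewrite mulrC; exact: (smZ (ann_submod _ hP) b uc).
by exact: (smZ (ann_submod _ hP) c (bL w wL)).
Qed.

End Modulo.

Lemma has_reg_seq_preim (V W : lmodType A) (pi : {linear V -> W}) n (P : set W) :
  (forall w, exists v, w = pi v) -> has_reg_seq n [set v | P (pi v)] -> has_reg_seq n P.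
Proof.
move=> pis; elim: n P => //= n IH P [x [Mx rx hx]]; exists x; split=> //.
  by move=> w; have [v ->] := pis w; rewrite -linearZ => /rx.
apply: IH; move: hx; congr (has_reg_seq n _); apply/seteqP; split=> v.
  by move=> [p [w [hp ->]]]; exists (pi p), (pi w); rewrite linearD linearZ.
move=> [p [w [hp piv]]]; have [w' wE] := pis w.
exists (v - x *: w'), w'; split; last by rewrite subrK.
by rewrite /= linearB linearZ /= -wE piv addrK.
Qed.

Section Seq.
Variable V : lmodType A.

Lemma seq_submoduleP (s : seq A) x :
  seq_submodule V s x <->
  exists v : nat -> V, x = \sum_(i < size s) s`_i *: v i.
Proof.
split=> [[v ->]|[v ->]]; last by exists (fun i => v i).
exists (fun i => if insub i is Some j then v j else 0).
by apply: eq_bigr => i _; rewrite valK.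
Qed.

Lemma seq_submodule_rcons (s : seq A) a :
  seq_submodule V (rcons s a) = add_mult (seq_submodule V s) a.
Proof.
apply/seteqP; split=> x.
  move=> /seq_submoduleP[v]; rewrite size_rcons big_ord_recr /= => ->.
  exists (\sum_(i < size s) s`_i *: v i), (v (size s)); split.
    by apply/seq_submoduleP; exists v.
  rewrite nth_rcons ltnn eqxx; congr (_ + _); apply: eq_bigr => i _.
  by rewrite nth_rcons ltn_ord.
move=> [p [w [/seq_submoduleP[v ->] ->]]]; apply/seq_submoduleP.
exists (fun i => if (i < size s)%N then v i else w).
rewrite size_rcons big_ord_recr /= nth_rcons !ltnn eqxx; congr (_ + _).
by apply: eq_bigr => i _; rewrite nth_rcons !ltn_ord.
Qed.

Lemma regular_sequence_has_reg_seq (s : seq A) :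
  (forall x, x \in s -> M x) -> regular_sequence V s ->
  has_reg_seq (size s) [set (0 : V)].
Proof.
move=> sM [sreg _].
have -> : [set (0 : V)] = seq_submodule V (take 0 s).
  rewrite take0; apply/seteqP; split=> x.
    by move=> ->; exists (fun=> 0); rewrite big_ord0.
  by move=> [v ->]; rewrite big_ord0.
suff H k i : (i + k = size s)%N -> has_reg_seq k (seq_submodule V (take i s)) by exact: H.
elim: k i => //= k IH i ik.
have li : (i < size s)%N by rewrite -ik addnS ltnS leq_addr.
exists s`_i; split; [exact/sM/mem_nth|exact: sreg|].
by rewrite -seq_submodule_rcons -take_nth //; apply: IH; rewrite addSnnS.
Qed.

End Seq.

Hypotheses (A_noeth : noetherian A) (A_local : local_with_maximal_ideal M).

Section Avoid.
Variable V : lmodType A.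
Implicit Type P : set V.

Lemma max_ann_ex P w : submod P -> ~ P w ->
  exists v, max_ann P v /\ ann P w `<=` ann P v.
Proof.
move=> hP Pw.
have [||I [[v [Pv ->]] wv maxv]] := noeth_max (noeth_regular A_noeth)
  (F := fun I : set A^o => exists v, ~ P v /\ I = ann P v) (P0 := ann P w).
- by move=> _ [v [_ ->]]; exact: ann_submod.
- by exists w.
exists v; split=> //; split=> // u Pu vu; apply: maxv => //; by exists u.
Qed.

Hypothesis V_noeth : noeth_mod V.

(** Prime avoidance.  Take a finite list [L] of elements with maximal annihilator
    whose span over [P] is as large as possible.  This span then contains every
    element with maximal annihilator, so every maximal annihilator contains, hence
    equals, one coming from [L].  An element of [M] outside these finitely many
    primes is regular. *)
Lemma no_socle_reg P : submod P -> no_socle P -> exists2 x, M x & reg_mod x P.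
Proof.
move=> hP ns.
have [||_ [[L [Lm ->]] _ maxL]] := noeth_max V_noeth (F := fun Q : set V =>
  exists L, (forall u, u \in L -> max_ann P u) /\ Q = gen L P) (P0 := P).
- by move=> _ [L [_ ->]]; exact: gen_submod.
- by exists [::].
have genL v : max_ann P v -> gen L P v.
  move=> mv; apply: (maxL (gen (v :: L) P)).
  - exists (v :: L); split=> // u; rewrite in_cons => /orP[/eqP->//|]; exact: Lm.
  - by apply: gen_mono => // u uL; rewrite in_cons uL orbT.
  - by apply: gen_mem => //; exact: mem_head.
have annL v : max_ann P v -> exists2 u, u \in L & ann P u `<=` ann P v.
  move=> mv; apply: contrapT => h.
  have [|b [nb bL]] := prod_ann (L := L) hP mv.
    by move=> u uL uv; apply: h; exists u.
  apply: nb; apply: (gen_min (S := [set u | P (b *: u)])) (genL v mv) => //.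
    split=> /=; first by rewrite scaler0; exact: (sm0 hP).
      by move=> x y hx hy; rewrite scalerDr; exact: (smD hP).
    by move=> a x hx; rewrite scalerA mulrC -scalerA; exact: (smZ hP).
  by move=> u; exact: (smZ hP).
have [x Mx xL] : exists2 x, M x & forall u, u \in L -> ~ ann P u x.
  elim: L Lm {maxL genL annL} => [|u L IH] Lm.
    by exists 0 => //; exact: (sm0 (M_ideal A_local)).
  have [w wL|x Mx xL] := IH; first by apply: Lm; rewrite in_cons wL orbT.
  have [ux|nux] := pselect (ann P u x); last first.
    by exists x => // w; rewrite in_cons => /orP[/eqP->|/xL].
  have mu := Lm u (mem_head _ _).
  have [w wL wu|b [nb bL]] := prod_ann (L := L) hP mu.
    have [_ maxw] : max_ann P w by apply: Lm; rewrite in_cons wL orbT.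
    exact/(xL w wL)/(maxw u mu.1 wu).
  have [m Mm nm] : exists2 m, M m & ~ ann P u m.
    apply: contrapT => h; apply: mu.1; apply: ns => m Mm.
    by apply: contrapT => nm; apply: h; exists m.
  (* The product m * b lies in every prime of the list except the one of u. *)
  exists (x + m * b).
    apply: (smD (M_ideal A_local)) => //.
    by rewrite mulrC; exact: (smZ (M_ideal A_local)).
  move=> w; rewrite in_cons => /orP[/eqP->|wL].
    by move=> /(smD_r (ann_submod _ hP) ux)/(max_ann_prime hP mu)[].
  move=> wxb; apply: (xL w wL); apply: (smD_l (ann_submod _ hP) _ wxb).
  exact: (smZ (ann_submod _ hP) m (bL w wL)).
exists x => // v xv; apply: contrapT => Pv.
have [v' [mv' vv']] := max_ann_ex hP Pv.
have [u uL uv'] := annL v' mv'.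
by apply: (xL u uL); have [_ mu] := Lm u uL; exact: (mu _ mv'.1 uv' _ (vv' x xv)).
Qed.

End Avoid.

(** Prime avoidance in the direct sum of the two modules. *)
Lemma common_reg (V W : lmodType A) (P : set V) (Q : set W) :
  fin_gen V -> fin_gen W -> submod P -> submod Q -> no_socle P -> no_socle Q ->
  exists x, [/\ M x, reg_mod x P & reg_mod x Q].
Proof.
move=> fV fW hP hQ nP nQ.
have fN := fin_gen_noeth A_noeth (fin_gen_prod fV fW).
have [||x Mx rx] := no_socle_reg fN (P := [set v | P v.1 /\ Q v.2]).
- split; first by split; [exact: (sm0 hP)|exact: (sm0 hQ)].
    by move=> u v [? ?] [? ?]; split; [exact: (smD hP)|exact: (smD hQ)].
  by move=> a u [? ?]; split; [exact: (smZ hP)|exact: (smZ hQ)].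
- move=> v h; split; first by apply: nP => m /h[].
  by apply: nQ => m /h[].
exists x; split=> // v Pv.
  have [|] := rx (v, 0) => //; split=> //=.
  by rewrite scaler0; exact: (sm0 hQ).
have [|] := rx (0, v) => //; split=> //=.
by rewrite scaler0; exact: (sm0 hP).
Qed.

Section Exchange.
Variable V : lmodType A.
Implicit Type P : set V.
Hypothesis V_fg : fin_gen V.

(** The kernel [K] of [w] on [V / P] satisfies K = xK modulo [P], so it vanishes by
    Nakayama's lemma. *)
Lemma reg_swap P x w : submod P -> M x -> reg_mod x P -> reg_mod w (add_mult P x) ->
  reg_mod w P /\ reg_mod x (add_mult P w).
Proof.
move=> hP Mx rx rw; split=> [v wv|v].
  pose K := [set v | P (w *: v)].
  have hK : submod K.
    split; rewrite /K /=; first by rewrite scaler0; exact: (sm0 hP).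
      by move=> u z hu hz; rewrite scalerDr; exact: (smD hP).
    by move=> a u hu; rewrite scalerA mulrC -scalerA; exact: (smZ hP).
  apply: (nakayama A_noeth A_local hP _ hK Mx) wv.
    apply: rel_noethW (fin_gen_noeth A_noeth V_fg) => // _ ->; exact: (sm0 hP).
  move=> z Kz; have /rw[p [z' [Pp zE]]] := add_mult_sub (P := P) x Kz.
  exists z'; last by rewrite zE addrK.
  apply: rx; rewrite scalerA mulrC -scalerA; apply: (smD_r hP (x := w *: p)).
    exact: (smZ hP).
  by rewrite -scalerDr -zE.
move=> [p [n [Pp xvE]]].
have : add_mult P x (w *: n).
  by exists (- p), v; split; [exact: (smN hP)|rewrite xvE addKr].
move=> /rw[q [z [Pq nE]]].
have : P (x *: (v - w *: z)).
  rewrite scalerBr xvE nE scalerDr !scalerA mulrC [x * w]mulrC addrA addrK.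
  by apply: (smD hP) => //; exact: (smZ hP).
by move=> /rx h; exists (v - w *: z), z; rewrite subrK.
Qed.

(** If [v] is killed by [M] modulo P + xV, write z v = p + x n; then [n] is killed by
    [M] modulo P + zV, and [n] vanishes there only if [v] vanishes modulo P + xV. *)
Lemma no_socle_swap P x z : submod P -> reg_mod z P -> M z -> M x -> reg_mod x P ->
  no_socle (add_mult P z) -> no_socle (add_mult P x).
Proof.
move=> hP rz Mz Mx rx ns v hv.
have [p [n [Pp zvE]]] := hv z Mz.
have /ns[q [k [Pq nE]]] : forall m, M m -> add_mult P z (m *: n).
  move=> m Mm; have [p1 [n1 [Pp1 mvE]]] := hv m Mm.
  suff : P (x *: (m *: n - z *: n1)).
    by move=> /rx h; exists (m *: n - z *: n1), n1; rewrite subrK.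
  have -> : x *: (m *: n - z *: n1) = z *: p1 - m *: p.
    rewrite scalerBr !scalerA [x * m]mulrC [x * z]mulrC -!scalerA.
    have -> : x *: n = z *: v - p by rewrite zvE addrC addKr.
    have -> : x *: n1 = m *: v - p1 by rewrite mvE addrC addKr.
    by rewrite !scalerBr !scalerA [z * m]mulrC opprB addrC addrA subrK.
  by apply: (smB hP); exact: (smZ hP).
have : P (z *: (v - x *: k)).
  rewrite scalerBr zvE nE scalerDr !scalerA [z * x]mulrC addrA addrK.
  by apply: (smD hP) => //; exact: (smZ hP).
by move=> /rz h; exists (v - x *: k), k; rewrite subrK.
Qed.

(** If the given sequence starts with [z], pick [w] regular modulo both P + zV and
    P + xV.  Applied to P + zV, induction replaces the tail of the sequence by one
    that starts with [w]; swapping [w] and [z] and applying induction to P + wV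
    replaces [z] by [x]. *)
Lemma reg_seq_exchange n P x : submod P -> M x -> reg_mod x P -> has_reg_seq n.+1 P -> has_reg_seq n (add_mult P x).
Proof.
elim: n P x => // n IH P x hP Mx rx [z [Mz rz rsz]].
have [z2 [Mz2 rz2 _]] := rsz.
have nsz := reg_no_socle Mz2 rz2.
have nsx := no_socle_swap hP rz Mz Mx rx nsz.
have [w [Mw wz wx]] := common_reg V_fg V_fg (add_mult_submod z hP) (add_mult_submod x hP) nsz nsx.
have [rw zw] := reg_swap hP Mz rz wz.
have [_ xw] := reg_swap hP Mx rx wx.
have rszw := IH _ _ (add_mult_submod z hP) Mw wz rsz.
exists w; split=> //; rewrite add_multAC; apply: IH => //; first exact: add_mult_submod.
by exists z; split=> //; rewrite add_multAC.
Qed.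

End Exchange.
End Regular.

(** * Chains of primes *)

Section Dimension.
Variables (A : comPzRingType) (M : set A).
Hypotheses (A_noeth : noetherian A) (A_local : local_with_maximal_ideal M).
Implicit Type I : set A^o.

(** dim (A / I) is at most [n]. *)
Definition dim_le I n := forall m p, prime_chain_over (I : set A) m p -> (m <= n)%N.

Lemma add_mult_self I x : submod I -> add_mult I x x.
Proof.
move=> hI; exists 0, 1; split; first exact: (sm0 hI).
by rewrite add0r /GRing.scale /= mulr1.
Qed.

(** An ideal over [I] maximal among those that miss the products of a power of [x]
    with an element outside [p]; regularity of [x] ensures that [I] misses them. *)
Lemma prime_below I x (p : set A) : submod I -> reg_mod x I -> prime_ideal p ->
  I `<=` p -> p x -> exists q : set A, [/\ prime_ideal q, I `<=` q, q `<=` p & ~ q x].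
Proof.
move=> hI rx [hp p1 pp] Ip px.
pose S := [set y : A | exists k s, ~ p s /\ y = x ^+ k * s].
have SM a b : S a -> S b -> S (a * b).
  move=> [k [s [ps ->]]] [l [t [pt ->]]]; exists (k + l)%N, (s * t).
  by split; [move=> /pp[]|rewrite exprD mulrACA].
have IS a : I a -> ~ S a.
  move=> Ia [k [s [ps aE]]]; apply: ps; apply: Ip; rewrite aE in Ia.
  elim: k Ia {aE} => [|k IH]; first by rewrite expr0 mul1r.
  by rewrite exprS -mulrA => /rx/IH.
have [||q [[hq qS] Iq maxq]] := noeth_max (noeth_regular A_noeth)
  (F := fun Q : set A^o => submod Q /\ forall a, Q a -> ~ S a) (P0 := I).
- by move=> ? [].
- by [].
exists q; split=> //.
- split=> //.
    by move=> /qS; apply; exists 0%N, 1; rewrite mulr1.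
  move=> a b qab; apply: contrapT => h.
  have meets c : ~ q c -> exists d e, q d /\ S (d + c * e).
    move=> qc; apply: contrapT => nS; apply: qc.
    apply: (maxq (add_mult q c)); last 1 first.
    + exact: add_mult_self.
    + split; first exact: add_mult_submod.
      by move=> _ [d [e [qd ->]]] Sd; apply: nS; exists d, e.
    + exact: add_mult_sub.
  have [|d [e [qd Sd]]] := meets a; first by move=> qa; apply: h; left.
  have [|d' [e' [qd' Sd']]] := meets b; first by move=> qb; apply: h; right.
  apply: (qS _ _ (SM _ _ Sd Sd')).
  rewrite mulrDl; apply: (smD hq).
    by rewrite mulrC; exact: (smZ hq).
  rewrite mulrDr; apply: (smD hq); first exact: (smZ hq).
  by rewrite mulrACA mulrC; exact: (smZ hq).
- move=> a qa; apply: contrapT => pa; apply: (qS _ qa).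
  by exists 0%N, a; rewrite expr0 mul1r.
- by move=> qx; apply: (qS _ qx); exists 1%N, 1; rewrite expr1 mulr1.
Qed.

Lemma dim_le_add_mult I x n : submod I -> reg_mod x I -> dim_le I n.+1 -> dim_le (add_mult I x) n.
Proof.
move=> hI rx dI m p [pP pS].
have [p0 Ip0] := pP 0%N (leq0n _).
have [||q [qP Iq qp qx]] := prime_below hI rx p0.
- by move=> a Ia; apply: Ip0; apply: add_mult_sub.
- by apply: Ip0; exact: add_mult_self.
- suff /dI : prime_chain_over (I : set A) m.+1 (fun i => if i is j.+1 then p j else q) by [].
  split=> [[|i] im|[|i] im] //.
  + have [? h] := pP i im; by split=> // a Ia; apply: h; apply: add_mult_sub.
  + split=> // pq; apply: qx; apply: pq; apply: Ip0.
    exact: add_mult_self.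
  + exact: pS.
Qed.

Lemma M_prime : prime_ideal M.
Proof.
split; [exact: (M_ideal A_local)|exact: (M_proper A_local)|].
move=> a b Mab; have [|/(unit_notM A_noeth A_local)[c ca]] := pselect (M a); first by left.
by right; rewrite -[b]mul1r -ca -mulrA; exact: (smZ (M_ideal A_local)).
Qed.

(** A maximal annihilator in [A / J] is a prime over [I], hence equal to [M]. *)
Lemma dim0_socle I (J : set A^o) : dim_le I 0 -> I `<=` J -> submod J -> ~ J 1 ->
  exists2 s, ~ J s & forall m, M m -> J (m * s).
Proof.
move=> dI IJ hJ J1.
have [s [ms _]] := max_ann_ex A_noeth hJ J1.
have Jann a : J a -> ann J s a.
  by move=> Ja; rewrite /ann /= -[a *: s]/(a * s) mulrC; exact: (smZ hJ).
have pann : prime_ideal (ann J s : set A).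
  split; first exact: (ann_submod s hJ).
    by rewrite /ann /= scale1r; exact: ms.1.
  exact: max_ann_prime hJ ms.
exists s; first exact: ms.1.
have annM a : ann J s a -> M a.
  have [_ ann1 _] := pann.
  exact: (proper_ideal_sub A_noeth A_local (ann_submod s hJ) ann1).
apply: contrapT => nM.
suff /dI : prime_chain_over (I : set A) 1 (fun i => if i is 0%N then ann J s : set A else M) by [].
split=> [[|i] _|[|i] //= _].
- by split=> // a /IJ/Jann.
- by split; [exact: M_prime|move=> a /IJ/Jann/annM].
Qed.

End Dimension.

(** * Injectives among the modules killed by an ideal *)

Section RelativeInjectives.
Variable A : comPzRingType.
Implicit Types (I J : set A^o) (V E : lmodType A).

Definition killed I V := forall a (v : V), I a -> a *: v = 0.

(** Injectivity with respect to modules killed by [I], that is to [A / I]-modules,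
    when [E] itself is killed by [I]. *)
Definition inj_over I E := forall (X Y : lmodType A) (i : {linear X -> Y})
  (g : {linear X -> E}), killed I Y -> injective i ->
  exists h : {linear Y -> E}, forall x, h (i x) = g x.

(** The map from [A / (P : y)] to [E] that sends 1 to [w] is extended along the
    embedding of [A / (P : y)] in [V / P] that sends 1 to the class of [y]. *)
Lemma inj_over_extend I E V (P : set V) (y : V) (w : E) :
  inj_over I E -> submod P -> (forall a v, I a -> P (a *: v)) ->
  (forall a, P (a *: y) -> a *: w = 0) ->
  exists t : {linear V -> E}, (forall v, P v -> t v = 0) /\ t y = w.
Proof.
move=> hE hP IP yw.
pose Q := Submodule hP; pose N := Submodule (ann_submod y hP).
have [i iP] : exists i : {linear quo N -> quo Q},
    forall a : A, i (qlin N a) = a *: qlin Q y.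
  have [|i iP] := @quo_lift A _ N (quo Q) (line (qlin Q y)).
    by move=> a ya; rewrite /line lin_ofE -linearZ; apply/qlin_eq0.
  by exists i.
have [g gP] : exists g : {linear quo N -> E}, forall a : A, g (qlin N a) = a *: w.
  by have [|g gP] := @quo_lift A _ N E (line w); last by exists g.
have [||h hP'] := hE _ _ i g.
- by move=> a q Ia; have [v ->] := qlin_surj q; rewrite -linearZ; apply/qlin_eq0/IP.
- move=> p q; have [a ->] := qlin_surj p; have [b ->] := qlin_surj q => iab.
  apply/subr0_eq; rewrite -linearB; apply/qlin_eq0; rewrite /N /ann /=.
  apply/(qlin_eq0 Q); rewrite linearZ /= scalerBl.
  by apply/eqP; rewrite subr_eq0 -!iP iab.
exists (lcomp h (qlin Q)); split=> [v Pv|]; rewrite lcompE.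
  by have -> : qlin Q v = 0; [exact/qlin_eq0|rewrite linear0].
by rewrite -[qlin Q y]scale1r -iP hP' gP scale1r.
Qed.

(** Here Hom(A / J, E) is identified with the elements of [E] killed by [J]. *)
Lemma inj_over_elt I E J (s : A) (w : E) :
  inj_over I E -> submod J -> I `<=` J -> (forall a : A, J (a * s) -> a *: w = 0) ->
  exists w1 : E, (forall a, J a -> a *: w1 = 0) /\ s *: w1 = w.
Proof.
move=> hE hJ IJ sw.
have [||t [tJ ts]] := @inj_over_extend I E (A^o) J s w hE hJ.
- by move=> a v /IJ Ja; rewrite /GRing.scale /= mulrC; exact: (smZ hJ).
- exact: sw.
have tE a : t a = a *: t 1 by rewrite -linearZ /GRing.scale /= mulr1.
by exists (t 1); split=> [a /tJ|]; rewrite -tE.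
Qed.

Lemma inj_over_div I E (x : A) (e : E) :
  inj_over I E -> killed I E -> submod I -> reg_mod x I -> exists e', x *: e' = e.
Proof.
move=> hE kE hI rx; have [|||e' [_ h]] := inj_over_elt (J := I) (s := x) (w := e) hE.
- by [].
- by [].
- by move=> a; rewrite mulrC => /rx/kE.
by exists e'.
Qed.

(** Extension along multiplication by [x] on [V]. *)
Lemma inj_over_divhom I E V (x : A) (g : {linear V -> E}) :
  inj_over I E -> killed I V -> (forall v : V, x *: v = 0 -> v = 0) ->
  exists h : {linear V -> E}, forall v, x *: h v = g v.
Proof.
move=> hE kV rx; have [||h hP] := hE _ _ ( *:%R x : {linear V -> V}) g => //.
  move=> u v /= uv; apply/subr0_eq/rx.
  by rewrite scalerBr uv subrr.
by exists h => v; rewrite -hP -linearZ.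
Qed.

Fact tors_submod x E : submod [set e : E | x *: e = 0].
Proof.
split=> /=; first exact: scaler0.
  by move=> u v hu hv; rewrite scalerDr hu hv addr0.
by move=> a u hu; rewrite scalerA mulrC -scalerA hu scaler0.
Qed.
Definition tors x E := Submodule (tors_submod x E).

Lemma killed_add_mult I x V : submod I ->
  killed (add_mult I x) V <-> killed I V /\ forall v : V, x *: v = 0.
Proof.
move=> hI; split=> [h|[h hx] _ v [p [w [Ip ->]]]]; last first.
  by rewrite scalerDl h // add0r -[x *: w]/(x * w) mulrC -scalerA hx scaler0.
split=> [a v Ia|v]; first by apply: h; exact: add_mult_sub.
by apply: h; exact: add_mult_self.
Qed.

Lemma tors_killed I x E : submod I -> killed I E -> killed (add_mult I x) (sm_type (tors x E)).
Proof.
move=> hI kE; apply/(killed_add_mult _ _ hI); split=> [a v Ia|v]; apply: sm_val_inj.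
  by rewrite /= kE.
exact: (sm_valP v).
Qed.

Lemma tors_inj I x E : submod I -> inj_over I E ->
  inj_over (add_mult I x) (sm_type (tors x E)).
Proof.
move=> hI hE X Y i g /(killed_add_mult _ _ hI)[kY xY] ii.
have [h hP] := hE _ _ i (lcomp (sm_lin (tors x E)) g) kY ii.
have [u|h' h'P] := @sm_corestr A E (tors x E) Y h.
  by rewrite /= -linearZ xY linear0.
by exists h' => u; apply: sm_val_inj; rewrite h'P hP.
Qed.

Lemma summand_inj I E (K : lmodType A) (j : {linear K -> E}) (p : {linear E -> K}) :
  (forall k, p (j k) = k) -> inj_over I E -> inj_over I K.
Proof.
move=> pj hE X Y i g kY ii; have [h hP] := hE _ _ i (lcomp j g) kY ii.
by exists (lcomp p h) => u; rewrite /= hP /= pj.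
Qed.

(** Injective resolutions over [A / I], in terms of [A]-modules. *)
Record ires I C := IRes {
  imod : nat -> lmodType A;
  idiff : forall n, {linear imod n -> imod n.+1};
  iaug : {linear C -> imod 0%N};
  imod_inj : forall n, inj_over I (imod n);
  imod_killed : forall n, killed I (imod n);
  iaug_inj : injective iaug;
  iexact0 : forall x, idiff 0%N x = 0 <-> exists y, x = iaug y;
  iexactS : forall n x, idiff n.+1 x = 0 <-> exists y, x = idiff n y
}.

Lemma ires_dd I C (R : ires I C) n x : idiff R n.+1 (idiff R n x) = 0.
Proof. by apply/iexactS; exists x. Qed.

Lemma ires_da I C (R : ires I C) x : idiff R 0 (iaug R x) = 0.
Proof. by apply/iexact0; exists x. Qed.

End RelativeInjectives.

(** * Reduction of a resolution modulo a regular element *)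

Section Compress.
Variables (A : comPzRingType) (I : set A^o) (C W : lmodType A) (R : ires I C).
Variables (x : A) (q : {linear C -> W}).
Hypotheses (hI : submod I) (x_regI : reg_mod x I) (x_regC : forall c : C, x *: c = 0 -> c = 0).
Hypotheses (q_surj : forall w, exists c, w = q c)
  (q_ker : forall c, q c = 0 <-> exists c', c = x *: c').

Local Notation E := (imod R).
Local Notation d := (idiff R).
Local Notation aug := (iaug R).
Local Notation I' := (add_mult I x).
Local Notation T0 := (sm_type (tors x (E 0))).
Local Notation T1 := (sm_type (tors x (E 1))).

Lemma ires_div n (e : E n) : exists e', x *: e' = e.
Proof. exact: inj_over_div (@imod_inj _ _ _ R n) (@imod_killed _ _ _ R n) hI x_regI. Qed.

(** E^0[x] is injective among the modules killed by I + xA, and it embeds in E^1[x]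
    through the differential because [x] is regular on [C]. *)
Lemma ires_retract : exists r : {linear T1 -> T0},
  forall (t : T0) (t' : T1), sm_val t' = d 0 (sm_val t) -> r t' = t.
Proof.
have [t|dT dTP] := @sm_corestr A _ (tors x (E 1)) _ (lcomp (d 0) (sm_lin (tors x (E 0)))).
  by rewrite /= -linearZ (sm_valP t) linear0.
have [||r rP] := @tors_inj _ _ x _ hI (@imod_inj _ _ _ R 0) _ _ dT (idfun : {linear T0 -> T0}).
- apply: tors_killed => //; exact: imod_killed.
- move=> s t st; apply/subr0_eq; apply: sm_val_inj.
  have : d 0 (sm_val (s - t)) = 0.
    by have := dTP (s - t); rewrite /= linearB st subrr => <-.
  move=> /iexact0[c stc]; have /x_regC c0 : x *: c = 0.
    apply: (@iaug_inj _ _ _ R); rewrite linearZ linear0 /= -stc.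
    exact: (sm_valP (s - t)).
  by rewrite stc c0 linear0.
exists r => t t' tt'; rewrite -[RHS]rP; congr (r _); apply: sm_val_inj.
by rewrite dTP.
Qed.

Variable r : {linear T1 -> T0}.
Hypothesis rP : forall (t : T0) (t' : T1), sm_val t' = d 0 (sm_val t) -> r t' = t.

Fact ker_submod : submod [set t | r t = 0].
Proof.
split=> /=; first exact: linear0.
  by move=> s t hs ht; rewrite linearD hs ht addr0.
by move=> a t ht; rewrite linearZ ht /= scaler0.
Qed.
Let K := Submodule ker_submod.

Lemma compress_proj : exists p : {linear T1 -> sm_type K},
  forall t, sm_val (sm_val (p t)) = sm_val t - d 0 (sm_val (r t)).
Proof.
have TP (t : T1) : x *: (sm_val t - d 0 (sm_val (r t))) = 0.
  by rewrite scalerBr (sm_valP t) -linearZ (sm_valP (r t)) linear0 subr0.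
have pL : linear (fun t : T1 => sm_val t - d 0 (sm_val (r t))).
  by move=> a s t; rewrite linearP /= linearP opprD addrACA scalerBr -scalerN.
have [t|p0 p0P] := @sm_corestr A _ (tors x (E 1)) _ (lin_of pL); first exact: TP.
have [t|p pP] := @sm_corestr A _ K _ p0; last by exists p => t; rewrite pP p0P.
rewrite /=; pose s := p0 t - t.
have : r s = - r t.
  by apply: rP; rewrite /s /= p0P /= addrC addKr -linearN.
by rewrite /s linearB /= => /eqP; rewrite subr_eq addNr => /eqP.
Qed.

(** The complex E^1[x] -> E^2[x] -> ..., in whose first term the image of E^0[x] is
    replaced by its complement [K], the kernel of the retraction. *)
Definition compressed_mod n : lmodType A :=
  if n is m.+1 then sm_type (tors x (E m.+2)) else sm_type K.

Definition compressed_inc n : {linear compressed_mod n -> E n.+1} :=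
  match n return {linear compressed_mod n -> E n.+1} with
  | 0%N => lcomp (sm_lin (tors x (E 1))) (sm_lin K)
  | m.+1 => sm_lin (tors x (E m.+2))
  end.

Lemma compressed_inc_inj n : injective (compressed_inc n).
Proof.
case: n => [|n] u v /=; last exact: sm_val_inj.
by move=> h; apply: sm_val_inj; apply: sm_val_inj.
Qed.

Lemma compressed_inc_tors n e : x *: compressed_inc n e = 0.
Proof. case: n e => [|n] e; [exact: (sm_valP (sm_val e))|exact: (sm_valP e)]. Qed.

Lemma compressed_inc_im n (e : E n.+2) : x *: e = 0 -> exists k : compressed_mod n.+1, compressed_inc n.+1 k = e.
Proof. by move=> xe; exists (@sm_in A _ (tors x (E n.+2)) e xe). Qed.

(** The term [t] is needed in degree 0 only, where it is the component in E^0[x].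
    That the decomposition respects annihilators is what transports socles. *)
Lemma compressed_inc_decomp n (e : E n.+1) : x *: e = 0 -> exists (k : compressed_mod n) (t : E n),
  [/\ x *: t = 0, e = compressed_inc n k + d n t &
      forall a, a *: e = 0 -> a *: k = 0 /\ a *: t = 0].
Proof.
case: n e => [|n] e xe; last first.
  exists (@sm_in A _ (tors x (E n.+2)) e xe), 0; split; first exact: scaler0.
    by rewrite linear0 addr0.
  by move=> a ae; rewrite scaler0; split=> //; apply: sm_val_inj.
have [p pP] := compress_proj; pose t : T1 := @sm_in A _ (tors x (E 1)) e xe.
exists (p t), (sm_val (r t)); split; first exact: (sm_valP (r t)).
  by rewrite /= pP subrK.
move=> a ae; have at0 : a *: t = 0 by apply: sm_val_inj.
by rewrite -[a *: sm_val _]/(sm_val (a *: r t)) -!linearZ at0 !linear0.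
Qed.

Lemma compressed_inc_cap (k : compressed_mod 0) (t : E 0) : x *: t = 0 -> compressed_inc 0 k = d 0 t -> k = 0.
Proof.
move=> xt /= kt; apply: sm_val_inj; apply: sm_val_inj.
have rk : r (sm_val k) = @sm_in A _ (tors x (E 0)) t xt by apply: rP.
have := sm_valP k; rewrite /= rk => /(congr1 (@sm_val _ _ _)) /= t0.
by rewrite kt t0 linear0.
Qed.

(** As [x] is surjective on each E^n, the sequence 0 -> E[x] -> E -> E -> 0 is exact,
    and [x] is injective on [C]; hence E[x] has cohomology C / xC in degree 1 only.
    The augmentation sends the class of [c] to the [K]-component of d(e), where
    x e is the image of [c] in E^0. *)
Lemma compress_aux : exists R' : ires I' W,
  exists inc : forall n, {linear imod R' n -> E n.+1},
  [/\ forall n, injective (inc n),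
      forall n e, inc n.+1 (idiff R' n e) = d n.+1 (inc n e),
      forall n e, x *: inc n e = 0,
      forall n (e : E n.+2), x *: e = 0 -> exists k, inc n.+1 k = e &
      (forall n (e : E n.+1), x *: e = 0 -> exists k t,
        [/\ x *: t = 0, e = inc n k + d n t &
            forall a, a *: e = 0 -> a *: k = 0 /\ a *: t = 0]) /\
      forall k t, x *: t = 0 -> inc 0%N k = d 0 t -> k = 0].
Proof.
have [d1 d1P] : exists d1 : forall n, {linear compressed_mod n -> compressed_mod n.+1},
    forall n e, compressed_inc n.+1 (d1 n e) = d n.+1 (compressed_inc n e).
  have dex n : exists h : {linear compressed_mod n -> compressed_mod n.+1},
      forall e, compressed_inc n.+1 (h e) = d n.+1 (compressed_inc n e).
    have [e|h hP] := @sm_corestr A _ (tors x (E n.+2)) _ (lcomp (d n.+1) (compressed_inc n)).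
      by rewrite /= -linearZ compressed_inc_tors linear0.
    by exists h.
  by exists (fun n => projT1 (cid (dex n))) => n; exact: (projT2 (cid (dex n))).
have [p pP] := compress_proj.
pose G (w : W) (k : compressed_mod 0) := exists (c : C) (e : E 0) (t : T1),
  [/\ w = q c, x *: e = aug c, sm_val t = d 0 e & k = p t].
have pd (t : T1) (e : E 0) : x *: e = 0 -> sm_val t = d 0 e -> p t = 0.
  move=> xe te; apply: sm_val_inj; apply: sm_val_inj; rewrite pP.
  by rewrite (rP (t := @sm_in A _ (tors x (E 0)) e xe) te) /= te subrr.
have [|||a1 a1P] := @lin_of_rel A W (compressed_mod 0) G.
- move=> w; have [c ->] := q_surj w; have [e xe] := ires_div (aug c).
  have xde : x *: d 0 e = 0 by rewrite -linearZ xe ires_da.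
  pose t : T1 := @sm_in A _ (tors x (E 1)) (d 0 e) xde.
  by exists (p t), c, e, t.
- move=> a w k w' k' [c [e [t [-> xe te ->]]]] [c' [e' [t' [-> xe' te' ->]]]].
  exists (a *: c + c'), (a *: e + e'), (a *: t + t'); split; rewrite ?linearP //.
    by rewrite /= xe xe'.
  by rewrite /= te te'.
- move=> k [c [e [t [/esym/q_ker[c' ->] xe te ->]]]].
  apply: (pd _ (e - aug c')); first by rewrite scalerBr xe linearZ subrr.
  by rewrite linearB /= ires_da subr0.
have a1d w : d 1 (compressed_inc 0 (a1 w)) = 0.
  have [c [e [t [_ _ te ->]]]] := a1P w.
  by rewrite /= pP linearB te !ires_dd subr0.
unshelve eexists (@IRes A I' W compressed_mod d1 a1 _ _ _ _ _).
- case=> [|n]; last by apply: tors_inj => //; exact: imod_inj.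
  apply: (summand_inj (j := sm_lin K) (p := p)); last by apply: tors_inj => //; exact: imod_inj.
  move=> k; apply: sm_val_inj; apply: sm_val_inj; rewrite pP.
  by rewrite (sm_valP k : r (sm_val k) = 0) /= linear0 subr0.
- case=> [|n]; last by apply: tors_killed => //; exact: imod_killed.
  move=> a k Ia; apply: sm_val_inj.
  by apply: (@tors_killed _ I x _ hI) Ia; exact: imod_killed.
- move=> w w' ww'; apply/subr0_eq.
  have : a1 (w - w') = 0 by rewrite linearB ww' subrr.
  have [c [e [t [-> xe te ->]]]] := a1P (w - w').
  move=> /(congr1 (fun k : sm_type K => sm_val (sm_val k))); rewrite pP te /= => /eqP.
  rewrite -linearB => /eqP/iexact0[c' ec']; apply/q_ker; exists c'.
  apply: (@iaug_inj _ _ _ R); rewrite -xe linearZ /= -ec' scalerBr.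
  by rewrite (sm_valP (r t)) subr0.
- move=> k; split=> [/(congr1 (compressed_inc 1))|[w ->]]; last first.
    by apply: (@compressed_inc_inj 1); rewrite d1P a1d linear0.
  rewrite d1P linear0 => /iexactS[e ke].
  have /iexact0[c ec] : d 0 (x *: e) = 0 by rewrite linearZ /= -ke compressed_inc_tors.
  exists (q c); have [c' [e' [t' [qc' xe' te' ->]]]] := a1P (q c).
  have /q_ker[c0 c0E] : q (c' - c) = 0 by rewrite linearB -qc' subrr.
  have : p (sm_val k - t') = 0.
    apply: (pd _ (e - e' + aug c0)).
      by rewrite scalerDr scalerBr xe' ec -linearZ -c0E -linearB -linearD addrA subrK subrr linear0.
    by rewrite linearD linearB /= ires_da addr0 -te' -ke.
  rewrite linearB => /subr0_eq <-; apply: sm_val_inj; apply: sm_val_inj.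
  by rewrite pP (sm_valP k : r (sm_val k) = 0) /= linear0 subr0.
- move=> n k; split=> [/(congr1 (compressed_inc n.+2))|[k' ->]]; last first.
    by apply: (@compressed_inc_inj n.+2); rewrite !d1P ires_dd linear0.
  rewrite d1P linear0 => /iexactS[e ke].
  have /iexactS[f xef] : d n.+1 (x *: e) = 0 by rewrite linearZ /= -ke compressed_inc_tors.
  have [f' ff'] := ires_div f.
  have [|k' [t [_ eE _]]] := @compressed_inc_decomp n (e - d n f').
    by rewrite scalerBr xef -linearZ ff' subrr.
  exists k'; apply: (@compressed_inc_inj n.+1); rewrite d1P ke.
  have := congr1 (d n.+1) eE; rewrite linearB linearD /= !ires_dd subr0 addr0.
  by [].
exists compressed_inc; split.
- exact: compressed_inc_inj.
- exact: d1P.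
- exact: compressed_inc_tors.
- exact: compressed_inc_im.
- by split; [exact: compressed_inc_decomp|exact: compressed_inc_cap].
Qed.

End Compress.

(** The resolution [R'] is described through its embedding in [R], one degree up. *)
Lemma compress (A : comPzRingType) (I : set A^o) (C W : lmodType A) (R : ires I C)
    (x : A) (q : {linear C -> W}) :
  submod I -> reg_mod x I -> (forall c : C, x *: c = 0 -> c = 0) ->
  (forall w, exists c, w = q c) -> (forall c, q c = 0 <-> exists c', c = x *: c') ->
  exists R' : ires (add_mult I x) W,
  exists inc : forall n, {linear imod R' n -> imod R n.+1},
  [/\ forall n, injective (inc n),
      forall n e, inc n.+1 (idiff R' n e) = idiff R n.+1 (inc n e),
      forall n e, x *: inc n e = 0,
      forall n (e : imod R n.+2), x *: e = 0 -> exists k, inc n.+1 k = e &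
      (forall n (e : imod R n.+1), x *: e = 0 -> exists k t,
        [/\ x *: t = 0, e = inc n k + idiff R n t &
            forall a, a *: e = 0 -> a *: k = 0 /\ a *: t = 0]) /\
      forall k t, x *: t = 0 -> inc 0%N k = idiff R 0 t -> k = 0].
Proof.
move=> hI rI rC qs qk; have [r rP] := ires_retract R hI rC.
exact: (compress_aux hI rI qs qk rP).
Qed.

(** * The zero-dimensional case *)

Section ZeroDimensional.
Variables (A : comPzRingType) (M : set A).
Hypotheses (A_noeth : noetherian A) (A_local : local_with_maximal_ideal M).
Variables (I : set A^o) (C : lmodType A) (R : ires I C).
Hypotheses (hI : submod I) (I_proper : ~ I 1) (I_dim : dim_le I 0).
Variable N : nat.
Hypothesis R_fin : forall i, (N < i)%N -> forall e : imod R i, e = 0.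

Local Notation E := (imod R).
Local Notation d := (idiff R).

Definition elt_ann (V : lmodType A) (v : V) : set A^o := [set a | a *: v = 0].

Lemma elt_ann_submod (V : lmodType A) (v : V) : submod (elt_ann v).
Proof. exact: (ann_submod v (@submod0 A V)). Qed.

(** Ext^(i+1)(A / J, C) = 0. *)
Definition cyclic_acyclic (J : set A^o) i := forall z : E i.+1,
  (forall a, J a -> a *: z = 0) -> d i.+1 z = 0 ->
  exists2 w : E i, forall a, J a -> a *: w = 0 & d i w = z.

(** Elements outside [M] are invertible. *)
Lemma colon_sub_M (J : set A^o) (s a : A) : submod J -> ~ J s -> J (a * s) -> M a.
Proof.
move=> hJ Js Jas; apply: contrapT => /(unit_notM A_noeth A_local)[b ba].
by apply: Js; rewrite -[s]mul1r -ba -mulrA; exact: (smZ hJ).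
Qed.

Lemma ires_killed : killed I C.
Proof.
move=> a c Ia; apply: (@iaug_inj _ _ _ R); rewrite linearZ linear0.
exact: imod_killed.
Qed.

(** The case of [A / M], which embeds in [A / I] through an element t of the socle:
    Ext^(i+1)(A / I, C) = 0 by exactness, and Ext^(i+2)(A / (I + tA), C) = 0 by the
    hypothesis. *)
Lemma socle_lift i (z : E i.+1) :
  (forall J : set A^o, submod J -> I `<=` J -> cyclic_acyclic J i.+1) ->
  (forall a, M a -> a *: z = 0) -> d i.+1 z = 0 ->
  exists2 w : E i, forall a, M a -> a *: w = 0 & d i w = z.
Proof.
move=> IH Mz dz.
have [t It Mt] := dim0_socle A_noeth A_local I_dim (@subset_refl _ I) hI I_proper.
have [|e [_ te]] := inj_over_elt (s := t) (w := z) (@imod_inj _ _ _ R _) hI (@subset_refl _ I).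
  by move=> a Iat; apply: Mz; exact: colon_sub_M Iat.
have [||||w kw dw] := IH (elt_ann (d i.+1 e)) _ _ (d i.+1 e).
- exact: elt_ann_submod.
- by move=> a Ia; apply: imod_killed.
- by [].
- exact: ires_dd.
have /iexactS[v ev] : d i.+1 (e - w) = 0 by rewrite linearB dw subrr.
(* The cocycle e - w is the coboundary of v, and t kills w. *)
exists (t *: v).
  by move=> m Mm; rewrite scalerA; apply: imod_killed; exact: Mt.
rewrite linearZ /= -ev scalerBr te kw ?subr0 //.
by rewrite /elt_ann /= -linearZ te dz.
Qed.

(** For an ideal [J] maximal among the counterexamples and s outside [J] with Ms in
    [J], the sequence 0 -> A / M -> A / J -> A / (J + sA) -> 0 gives a contradiction. *)
Lemma acyclic_step i :
  (forall J : set A^o, submod J -> I `<=` J -> cyclic_acyclic J i.+1) ->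
  forall J : set A^o, submod J -> I `<=` J -> cyclic_acyclic J i.
Proof.
move=> IH J0 hJ0 IJ0; apply: contrapT => nJ0.
have [||J [[hJ IJ nJ] _ maxJ]] := noeth_max (noeth_regular A_noeth)
  (F := fun J : set A^o => [/\ submod J, I `<=` J & ~ cyclic_acyclic J i]) (P0 := J0).
- by move=> J [].
- by [].
apply: nJ => z Jz dz.
have [J1|J1] := pselect (J 1).
  exists 0; first by move=> a _; rewrite scaler0.
  by rewrite linear0 -[z]scale1r Jz.
have [s Js Ms] := dim0_socle A_noeth A_local I_dim IJ hJ J1.
have [||w Mw dw] := @socle_lift i (s *: z) IH.
- by move=> m Mm; rewrite scalerA; apply: Jz; exact: Ms.
- by rewrite linearZ /= dz scaler0.
have [|w1 [Jw1 sw1]] := inj_over_elt (s := s) (w := w) (@imod_inj _ _ _ R _) hJ IJ.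
  by move=> a Jas; apply: Mw; exact: colon_sub_M Jas.
have acJ' : cyclic_acyclic (add_mult J s) i.
  apply: contrapT => nJ'; apply: Js; apply: (maxJ (add_mult J s)).
  - split=> //; first exact: add_mult_submod.
    by move=> a /IJ Ja; apply: add_mult_sub.
  - exact: add_mult_sub.
  - exact: add_mult_self.
have [||w2 Jw2 dw2] := acJ' (z - d i w1).
- move=> _ [p [b [Jp ->]]]; rewrite scalerDl scalerBr Jz // -linearZ Jw1 // linear0 subr0 add0r.
  rewrite -[s *: b]/(s * b) mulrC -scalerA scalerBr -dw -linearZ sw1 subrr.
  exact: scaler0.
- by rewrite linearB ires_dd dz subr0.
exists (w1 + w2); last by rewrite linearD dw2 addrC subrK.
by move=> a Ja; rewrite scalerDr Jw1 // Jw2 ?addr0 //; apply: add_mult_sub.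
Qed.

(** Descending induction on the degree, starting where the resolution vanishes. *)
Lemma zero_dim_acyclic i (J : set A^o) : submod J -> I `<=` J -> cyclic_acyclic J i.
Proof.
suff H k j (J' : set A^o) : (N < j + k)%N -> submod J' -> I `<=` J' -> cyclic_acyclic J' j.
  by apply: (H N.+1); rewrite addnS ltnS leq_addl.
elim: k j J' => [|k IH] j J' Nj.
  move=> _ _ z _ _; exists 0; first by move=> a _; rewrite scaler0.
  rewrite linear0; apply/esym/R_fin; rewrite addn0 in Nj; exact: ltnW.
by apply: acyclic_step => J''; apply: IH; rewrite addSnnS.
Qed.

Variable s0 : C.
Hypotheses (s0_neq0 : s0 <> 0) (s0_soc : forall a, M a -> a *: s0 = 0)
  (s0_gen : forall c : C, (forall a, M a -> a *: c = 0) -> exists a, c = a *: s0).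

(** The map from the submodule of [A / J] generated by s, a copy of [A / M], to [C]
    that sends s to [s0] extends to [A / J], as Ext^1(A / (J + sA), C) = 0. *)
Lemma socle_divides (J : set A^o) (s : A) : submod J -> I `<=` J -> ~ J s ->
  (forall m, M m -> J (m * s)) ->
  exists2 c : C, forall a, J a -> a *: c = 0 & s *: c = s0.
Proof.
move=> hJ IJ Js Ms.
have [|e [Je se]] := inj_over_elt (s := s) (w := iaug R s0) (@imod_inj _ _ _ R _) hJ IJ.
  by move=> a Jas; rewrite -linearZ s0_soc ?linear0 //; exact: colon_sub_M Jas.
have [||||w kw dw] := @zero_dim_acyclic 0 (elt_ann (d 0 e)) _ _ (d 0 e).
- exact: elt_ann_submod.
- by move=> a Ia; apply: imod_killed.
- by [].
- exact: ires_dd.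
have /iexact0[c ec] : d 0 (e - w) = 0 by rewrite linearB dw subrr.
exists c => [a Ja|]; apply: (@iaug_inj _ _ _ R); rewrite linearZ /= -ec scalerBr.
  by rewrite Je // kw ?subrr ?linear0 // /elt_ann /= -linearZ Je // linear0.
by rewrite se kw ?subr0 // /elt_ann /= -linearZ se ires_da.
Qed.

(** Matlis duality for [A / J], by noetherian induction on [J]: [u] is a homothety on
    C[J], the elements of [C] killed by [J].  If [u] acts as [a] on C[J + sA], then
    u - a factors through multiplication by [s] on C[J], whose values lie in the
    socle generated by [s0], so u - a is a multiple of [s] there. *)
Lemma zero_dim_end (u : {linear C -> C}) : exists a : A, forall c, u c = a *: c.
Proof.
pose scalar_on (J : set A^o) := exists a : A, forall c,
  (forall b, J b -> b *: c = 0) -> u c = a *: c.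
suff [a aP] : scalar_on I by exists a => c; apply: aP => b; exact: ires_killed.
apply: contrapT => nI.
have [||J [[hJ IJ nJ] _ maxJ]] := noeth_max (noeth_regular A_noeth)
  (F := fun J : set A^o => [/\ submod J, I `<=` J & ~ scalar_on J]) (P0 := I).
- by move=> J [].
- by split.
apply: nJ; have [J1|J1] := pselect (J 1).
  by exists 0 => c Jc; rewrite -[c]scale1r Jc // linear0 scaler0.
have [s Js Ms] := dim0_socle A_noeth A_local I_dim IJ hJ J1.
have [a aP] : scalar_on (add_mult J s).
  apply: contrapT => nJ'; apply: Js; apply: (maxJ (add_mult J s)).
  - split=> //; first exact: add_mult_submod.
    by move=> b /IJ Jb; apply: add_mult_sub.
  - exact: add_mult_sub.
  - exact: add_mult_self.
have aP' c : (forall b, J b -> b *: c = 0) -> s *: c = 0 -> u c = a *: c.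
  move=> Jc sc; apply: aP => _ [p [b [Jp ->]]].
  by rewrite scalerDl Jc // add0r -[s *: b]/(s * b) mulrC -scalerA sc scaler0.
have [c0 Jc0 sc0] := socle_divides hJ IJ Js Ms.
have [b0 b0P] : exists b, u c0 - a *: c0 = b *: s0.
  apply: s0_gen => m Mm; rewrite scalerBr -linearZ aP' ?scalerA ?[m * a]mulrC ?subrr //.
    by move=> b Jb; rewrite scalerA mulrC -scalerA Jc0 // scaler0.
  by rewrite [s * m]mulrC Jc0 //; exact: Ms.
(* On C[J], the difference u - a sends c0 to b0 times s0 = s c0. *)
exists (a + b0 * s) => c Jc.
have [b bP] : exists b, s *: c = b *: s0.
  by apply: s0_gen => m Mm; rewrite scalerA Jc //; exact: Ms.
have : u (c - b *: c0) = a *: (c - b *: c0).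
  apply: aP' => [e Je|].
    by rewrite scalerBr Jc // scalerA mulrC -scalerA Jc0 // scaler0 subrr.
  by rewrite scalerBr bP scalerA mulrC -scalerA sc0 subrr.
rewrite linearB linearZ /= scalerBr => /eqP; rewrite subr_eq => /eqP ->.
rewrite -addrA scalerDl; congr (_ + _).
have -> : u c0 = a *: c0 + b0 *: s0 by rewrite -b0P addrC subrK.
by rewrite scalerDr !scalerA [a * b]mulrC addKr -[RHS]scalerA bP scalerA mulrC.
Qed.

(** If [a] is not in [I], some multiple of [a] is a socle element of [A / I], and
    [socle_divides] shows that it does not kill [C]. *)
Lemma zero_dim_faithful (a : A) : (forall c : C, a *: c = 0) -> I a.
Proof.
move=> aC; apply: contrapT => Ia.
pose J : set A^o := [set b | I (b * a)].
have hJ : submod J.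
  split; rewrite /J /=; first by rewrite mul0r; exact: (sm0 hI).
    by move=> x y hx hy; rewrite mulrDl; exact: (smD hI).
  by move=> x y hy; rewrite -[x *: y]/(x * y) -mulrA; exact: (smZ hI).
have IJ : I `<=` J by move=> b Ib; rewrite /J /= mulrC; exact: (smZ hI).
have [|s Js Ms] := dim0_socle A_noeth A_local I_dim IJ hJ.
  by rewrite /J /= mul1r.
have [|c _ sc] := @socle_divides I (s * a) hI (@subset_refl _ I) Js.
- by move=> m Mm; rewrite mulrA; exact: Ms.
by apply: s0_neq0; rewrite -sc -scalerA aC scaler0.
Qed.

End ZeroDimensional.

(** * Ext modules and their finite generation *)

Section ExtFinite.
Variables (A : comPzRingType) (I : set A^o) (C : lmodType A) (R : ires I C).
Hypotheses (A_noeth : noetherian A) (hI : submod I).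

Local Notation E := (imod R).
Local Notation d := (idiff R).

(** The primitive [h] is corrected one generator [y] at a time: the defect of [h] at
    [y] is a cocycle killed by the annihilator of [y] modulo the previous
    generators. *)
Lemma acyclic_fin_gen i (V : lmodType A) (g : {linear V -> E i.+1}) :
  (forall J : set A^o, submod J -> I `<=` J -> cyclic_acyclic R J i) ->
  fin_gen V -> killed I V -> (forall v, d i.+1 (g v) = 0) ->
  exists h : {linear V -> E i}, forall v, d i (h v) = g v.
Proof.
move=> acy /fin_gen_gen[s sP] kV dg.
suff [h hP] : exists h : {linear V -> E i}, forall v, gen s [set 0] v -> d i (h v) = g v.
  by exists h => v; apply: hP.
elim: s {sP} => [|y s [h hP]].
  by exists (\0 : {linear V -> E i}) => v ->; rewrite !linear0.
pose P := gen s [set 0 : V]; have hP' : submod P := gen_submod s (@submod0 A V).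
have IP a v : I a -> P (a *: v) by move=> Ia; rewrite kV //; exact: (sm0 hP').
have [|||w kw dw] := acy (ann P y) (ann_submod y hP') _ (g y - d i (h y)).
- by move=> a; apply: IP.
- by move=> a Pay; rewrite scalerBr -!linearZ hP // subrr.
- by rewrite linearB dg ires_dd subr0.
have [t [tP ty]] := inj_over_extend (@imod_inj _ _ _ R i) hP' IP kw.
exists (lin_comb 1 h t) => _ [a [v [Pv ->]]].
have -> : lin_comb 1 h t (a *: y + v) = a *: (h y + w) + h v.
  by rewrite lin_combE scale1r (linearP h) (linearP t) ty tP // addr0 addrAC -scalerDr.
rewrite (linearP (d i)) (linearP g) (linearD (d i)) dw (hP _ Pv).
by rewrite [d i (h y) + _]addrC subrK.
Qed.

Definition cocycles (V : lmodType A) n : set (V -> E n) :=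
  [set g | linear g /\ forall v, d n (g v) = 0].

Definition coboundaries (V : lmodType A) n : set (V -> E n) :=
  match n with
  | 0%N => [set g | forall v, g v = 0]
  | m.+1 => [set g | exists h : {linear V -> E m}, forall v, g v = d m (h v)]
  end.

Lemma cocycles_submod V n : submod (@cocycles V n).
Proof.
split.
- split=> [a u v|v]; first by rewrite /= scaler0 addr0.
  exact: linear0.
- move=> g h [gL dg] [hL dh]; split=> [a u v|v].
    by rewrite !addrfctE /= gL hL scalerDr addrACA.
  by rewrite !addrfctE /= linearD dg dh addr0.
- move=> b g [gL dg]; split=> [a u v|v].
    by rewrite !scalrfctE /= gL scalerDr !scalerA mulrC.
  by rewrite !scalrfctE /= linearZ /= dg scaler0.
Qed.

Lemma coboundaries_submod V n : submod (@coboundaries V n).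
Proof.
case: n => [|n]; split=> /=.
- by [].
- by move=> g h g0 h0 v; rewrite !addrfctE /= g0 h0 addr0.
- by move=> a g g0 v; rewrite !scalrfctE /= g0 scaler0.
- by exists (\0 : {linear V -> E n}) => v; rewrite linear0.
- move=> g h [k kP] [l lP]; exists (lin_comb 1 k l) => v.
  by rewrite lin_combE scale1r linearD -kP -lP addrfctE.
- move=> a g [k kP]; exists (lin_comb a k (\0 : {linear V -> E n})) => v.
  by rewrite lin_combE addr0 linearZ /= -kP scalrfctE.
Qed.

End ExtFinite.

Section Transfer.
Variables (A : comPzRingType) (U U' : lmodType A).

(** Such a relation acts as an injective linear map from Z / B to Z' / B'. *)
Lemma rel_noeth_transfer (B Z : set U) (B' Z' : set U') (rho : U -> U' -> Prop) :
  submod B -> submod Z -> submod Z' ->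
  (forall g, Z g -> exists k, Z' k /\ rho g k) ->
  (forall a g g' k k', rho g k -> rho g' k' -> rho (a *: g + g') (a *: k + k')) ->
  (forall g k, Z g -> rho g k -> B' k -> B g) ->
  rel_noeth B' Z' -> rel_noeth B Z.
Proof.
move=> hB hZ hZ' tot lin refl N S hS SZ.
have rho00 : rho 0 0.
  have [k [_ h]] := tot 0 (sm0 hZ).
  by have := lin (-1) _ _ _ _ h h; rewrite scaler0 addr0 scaleN1r addNr.
pose S' : set U' := [set k | Z' k /\ exists2 g, S g & rho g k].
have hS' : submod S'.
  split.
  - by split; [exact: (sm0 hZ')|exists 0 => //; exact: (sm0 hS)].
  - move=> x y [Zx [g Sg gx]] [Zy [h Sh hy]]; split; first exact: (smD hZ').
    exists (1 *: g + h); first by rewrite scale1r; exact: (smD hS).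
    by rewrite -[x]scale1r; exact: lin.
  - move=> a x [Zx [g Sg gx]]; split; first exact: (smZ hZ').
    exists (a *: g + 0); first by rewrite addr0; exact: (smZ hS).
    by rewrite -[a *: x]addr0; exact: lin.
have [t [tS' S't]] := N S' hS' (fun k => @proj1 _ _).
have [s [sS sP]] : exists s, (forall g, g \in s -> S g) /\
    forall k g, gen t B' k -> Z g -> rho g k -> gen s B g.
  elim: t tS' {S't} => [|k1 t IH] tS'.
    by exists [::]; split=> // k g Bk Zg gk; exact: refl gk Bk.
  have [|s [sS sP]] := IH; first by move=> k kt; apply: tS'; rewrite in_cons kt orbT.
  have [_ [g1 Sg1 gk1]] := tS' k1 (mem_head _ _).
  exists (g1 :: s); split.
    by move=> g; rewrite in_cons => /orP[/eqP->//|]; exact: sS.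
  move=> _ g [a [y [ty ->]]] Zg gk; exists a, (- a *: g1 + g); split; last first.
    by rewrite scaleNr addrA subrr add0r.
  apply: (sP y) => //.
    by apply: (smD hZ) => //; apply: (smZ hZ); exact: SZ.
  by have := lin (- a) _ _ _ _ gk1 gk; rewrite [- a *: k1]scaleNr addKr.
exists s; split=> // g Sg; have [k [Zk gk]] := tot g (SZ g Sg).
apply: (sP k) => //; last exact: SZ.
by apply: S't; split=> //; exists g.
Qed.

Lemma sm_type_fin_gen (P : submodule U) : noeth_mod U -> fin_gen (sm_type P).
Proof.
move=> N; have [s [sP Ps]] := N P (sm_P P) (@subsetT _ _).
have [t tP] : exists t : seq (sm_type P), forall v : sm_type P,
    gen s [set 0] (sm_val v) -> gen t [set 0] v.
  elim: s sP {Ps} => [|g s IH] sP.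
    by exists [::] => v v0; apply: sm_val_inj.
  have [|t tP] := IH; first by move=> h hs; apply: sP; rewrite in_cons hs orbT.
  pose g' := sm_in (sP g (mem_head _ _)).
  exists (g' :: t) => v [a [y [hy vE]]]; exists a, (v - a *: g'); split.
    by apply: tP; rewrite /= vE addrC addKr.
  by rewrite addrC subrK.
by apply: (@gen_fin_gen _ _ t) => v; apply: tP; apply: Ps; exact: sm_valP.
Qed.

Lemma quo_fin_gen (P : submodule U) : fin_gen U -> fin_gen (quo P).
Proof.
move=> [n [g gP]]; exists n, (fun i => qlin P (g i)) => q.
have [v ->] := qlin_surj q; have [c ->] := gP v; exists c.
by rewrite linear_sum; apply: eq_bigr => i _; rewrite linearZ.
Qed.

End Transfer.

Section Power.
Variable A : comPzRingType.

(** [n.+1] copies of [V], with no trivial module needed at the start. *)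
Fixpoint pow (n : nat) (V : lmodType A) : lmodType A :=
  if n is m.+1 then (V * pow m V)%type else V.

Lemma pow_fin_gen n V : fin_gen V -> fin_gen (pow n V).
Proof. by move=> fV; elim: n => //= n; exact: fin_gen_prod. Qed.

Lemma pow_killed I n V : killed I V -> killed I (pow n V).
Proof.
move=> kV; elim: n => //= n IH a [u v] Ia.
by congr pair; [exact: kV|exact: IH].
Qed.

Lemma regular_fin_gen : fin_gen (A^o : lmodType A).
Proof.
by exists 1%N, (fun=> 1) => x; exists (fun=> x); rewrite big_ord1 /GRing.scale /= mulr1.
Qed.

End Power.

Section ExtNoetherian.
Variables (A : comPzRingType) (I : set A^o) (C : lmodType A) (R : ires I C).
Hypotheses (A_noeth : noetherian A) (hI : submod I) (C_fg : fin_gen C).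

Local Notation E := (imod R).
Local Notation d := (idiff R).
Local Notation Z V n := (@cocycles A I C R V n).
Local Notation B V n := (@coboundaries A I C R V n).
Let Q : lmodType A := quo (Submodule hI).

Lemma Q_killed : killed I Q.
Proof.
move=> a q Ia; have [b ->] := qlin_surj q; rewrite -linearZ; apply/qlin_eq0.
by rewrite /= /GRing.scale /= mulrC; exact: (smZ hI).
Qed.

(** [Q] = [A / I] is free on one generator among the modules killed by [I]. *)
Lemma Q_lift (V : lmodType A) (v : V) : killed I V ->
  exists h : {linear Q -> V}, forall a : A^o, h (qlin (Submodule hI) a) = (a : A) *: v.
Proof.
move=> kV; have [|h hP] := @quo_lift A _ (Submodule hI) V (line v); last by exists h.
by move=> a Ia; apply: kV.
Qed.

Lemma free_cover (V : lmodType A) (s : seq V) : killed I V ->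
  exists p : {linear pow (size s) Q -> V}, forall v, gen s [set 0] v -> exists u, p u = v.
Proof.
move=> kV; elim: s => [|y s [p pP]] /=.
  by exists (\0 : {linear Q -> V}) => v ->; exists 0.
have [h hP] := Q_lift y kV.
exists (lin_comb 1 (lcomp h (@fst_lin A Q (pow (size s) Q))) (lcomp p (@snd_lin A Q (pow (size s) Q)))).
move=> _ [a [v [/pP[u <-] ->]]].
exists (qlin (Submodule hI) a, u).
by rewrite lin_combE !lcompE scale1r /= hP.
Qed.

(** A cocycle is determined by its values at the generators of a free module, and
    these values are coboundaries by exactness. *)
Lemma free_acyclic n i (g : {linear pow n Q -> E i.+1}) :
  (forall v, d i.+1 (g v) = 0) ->
  exists h : {linear pow n Q -> E i}, forall v, d i (h v) = g v.
Proof.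
have Qacy (k : {linear Q -> E i.+1}) : (forall v, d i.+1 (k v) = 0) ->
    exists h : {linear Q -> E i}, forall v, d i (h v) = k v.
  move=> dk; have /iexactS[w kw] := dk (qlin (Submodule hI) 1).
  have [h hP] := Q_lift w (@imod_killed _ _ _ R i).
  exists h => q; have [a ->] := qlin_surj q; rewrite hP linearZ /= -kw -linearZ.
  by congr (k _); rewrite -linearZ /GRing.scale /= mulr1.
elim: n g => [|n IH] /= g dg; first exact: Qacy.
pose inl (q : Q) : Q * pow n Q := (q, 0).
pose inr (v : pow n Q) : Q * pow n Q := (0, v).
have inlL : linear inl by move=> a u v; congr pair; rewrite /= scaler0 addr0.
have inrL : linear inr by move=> a u v; congr pair; rewrite /= scaler0 addr0.
have [|h1 h1P] := Qacy (lcomp g (lin_of inlL)); first by move=> v; exact: dg.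
have [|h2 h2P] := IH (lcomp g (lin_of inrL)); first by move=> v; exact: dg.
exists (lin_comb 1 (lcomp h1 (@fst_lin A Q (pow n Q))) (lcomp h2 (@snd_lin A Q (pow n Q)))).
move=> [q v]; rewrite lin_combE scale1r !lcompE linearD h1P h2P !lcompE -linearD.
by congr (g _); congr pair; rewrite /= ?addr0 ?add0r.
Qed.

(** Evaluation at the generators of [V] embeds Hom(V, C) in a power of [C]. *)
Lemma ext0_noeth (V : lmodType A) : fin_gen V -> rel_noeth (B V 0) (Z V 0).
Proof.
move=> /fin_gen_gen[s sP].
pose evals := fix evals (s : seq V) (g : V -> E 0) : pow (size s) C -> Prop :=
  match s return pow (size s) C -> Prop with
  | [::] => fun k => k = 0
  | y :: s' => fun k => g y = iaug R (k : C * pow (size s') C).1 /\ evals s' g k.2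
  end.
apply: (@rel_noeth_transfer A _ (pow (size s) C) _ _ [set 0] setT (evals s)).
- exact: coboundaries_submod.
- exact: cocycles_submod.
- by [].
- move=> g [gL dg]; suff [k kP] : exists k, evals s g k by exists k.
  elim: (s) => [|y t [k kP]] /=; first by exists 0.
  by have /iexact0[c cP] := dg y; exists (c, k).
- move=> a g g'; elim: (s) => [|y t IH] /= k k'.
    by move=> -> ->; rewrite scaler0 addr0.
  by move=> [gk ?] [gk' ?]; split; [rewrite linearP /= -gk -gk'|exact: IH].
- move=> g k [gL dg] gk k0 v.
  have : gen s [set 0] v by exact: sP.
  have gE a u w : g (a *: u + w) = a *: g u + g w by exact: gL.
  have g0 : g 0 = 0 by have := gE (-1) 0 0; rewrite scaler0 addr0 scaleN1r addNr.
  rewrite {}k0 in gk; elim: (s) gk v {sP} => [|y t IH] /= gk v; first by move=> ->.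
  case: gk => gy gt [a [w [hw ->]]].
  by rewrite gE gy linear0 scaler0 add0r (IH gt).
- exact: (fin_gen_noeth A_noeth (pow_fin_gen _ C_fg)).
Qed.

(** Dimension shifting along 0 -> K -> F -> V -> 0 with [F] free over [A / I]: a
    cocycle on [V] becomes the coboundary of some [h] on [F], and its class vanishes
    when the restriction of [h] to [K] is a coboundary. *)
Lemma ext_noeth i (V : lmodType A) : fin_gen V -> killed I V ->
  rel_noeth (B V i) (Z V i).
Proof.
elim: i V => [|i IH] V fV kV; first exact: ext0_noeth.
have [s sP] := fin_gen_gen fV.
have [p p_surj] := free_cover s kV.
set F := pow (size s) Q in p p_surj.
have kF : killed I F := pow_killed Q_killed.
have fF : fin_gen F := pow_fin_gen _ (quo_fin_gen _ (@regular_fin_gen A)).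
have hK : submod [set u | p u = 0].
  split=> /=; first exact: linear0.
    by move=> u v pu pv; rewrite linearD pu pv addr0.
  by move=> a u pu; rewrite linearZ pu /= scaler0.
pose K := Submodule hK.
have fK : fin_gen (sm_type K) := sm_type_fin_gen K (fin_gen_noeth A_noeth fF).
have kK : killed I (sm_type K).
  by move=> a u Ia; apply: sm_val_inj; exact: kF.
apply: (@rel_noeth_transfer A _ (sm_type K -> E i) _ _ (B (sm_type K) i) (Z (sm_type K) i)
  (fun g k => exists h : {linear F -> E i}, (forall v, d i (h v) = g (p v)) /\
     forall u, k u = h (sm_val u))).
- exact: coboundaries_submod.
- exact: cocycles_submod.
- exact: cocycles_submod.
- move=> g [gL dg].
  have [|h hP] := @free_acyclic _ i (lcomp (lin_of gL) p); first by move=> v; exact: dg.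
  exists (fun u => h (sm_val u)); split; last by exists h.
  split=> [a u v|u]; first by rewrite /= linearP.
  by rewrite hP lcompE (sm_valP u : p _ = 0) linear0.
- move=> a g g' k k' [h [hg hk]] [h' [hg' hk']]; exists (lin_comb a h h'); split=> v.
    by rewrite lin_combE linearP /= hg hg'.
  by rewrite lin_combE -hk -hk'.
- move=> g k [gL dg] [h [hg hk]] Bk.
  have [h' [hg' hK']] : exists h' : {linear F -> E i},
      (forall v, d i (h' v) = g (p v)) /\ forall v, p v = 0 -> h' v = 0.
    case: i {IH} g gL dg h hg k hk Bk => [|i] g gL dg h hg k hk Bk.
      by exists h; split=> // v pv; have := Bk (@sm_in A F K v pv); rewrite hk.
    have [l lP] := Bk.
    have [L LP] := @imod_inj _ _ _ R i _ _ (sm_lin K) l kF (@sm_val_inj A F K).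
    exists (lin_comb (-1) (lcomp (d i) L) h); split=> v.
      by rewrite lin_combE lcompE linearP /= ires_dd scaler0 add0r hg.
    move=> pv; rewrite lin_combE lcompE; pose u := @sm_in A F K v pv.
    by have := LP u; rewrite /= => ->; rewrite -lP hk scaleN1r addNr.
  have [|||h0 h0P] := @lin_of_rel A V (E i) (fun v e => exists u, v = p u /\ e = h' u).
  + by move=> v; have [u <-] := p_surj v (sP v); exists (h' u), u.
  + move=> a _ _ _ _ [u [-> ->]] [u' [-> ->]].
    by exists (a *: u + u'); rewrite !linearP.
  + by move=> _ [u [/esym pu ->]]; exact: hK'.
  exists h0 => v; have [u [vu ->]] := h0P v.
  by rewrite hg' -vu.
- exact: IH.
Qed.

End ExtNoetherian.

(** * Type one *)

Section Type1.
Variables (A : comPzRingType) (M : set A).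

Definition M_killed (V : lmodType A) (v : V) := forall a, M a -> a *: v = 0.

Definition M_coboundary (I : set A^o) (C : lmodType A) (R : ires I C) n :
    imod R n -> Prop :=
  match n return imod R n -> Prop with
  | 0%N => fun z => z = 0
  | m.+1 => fun z => exists2 w : imod R m, M_killed w & idiff R m w = z
  end.

(** Ext^n(A / M, C) is one-dimensional over [A / M]; Hom(A / M, E^n) is identified with
    the elements of E^n killed by [M]. *)
Definition type1 (I : set A^o) (C : lmodType A) (R : ires I C) n :=
  exists e : imod R n, [/\ M_killed e, idiff R n e = 0, ~ M_coboundary e &
    forall z, M_killed z -> idiff R n z = 0 -> exists a, M_coboundary (z - a *: e)].

(** Ext^(n+1)(A / M, C) and Ext^n(A / M, C / xC) are isomorphic: an element killed by
    [M] is killed by [x], so it already lies in the complex of [R']. *)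
Lemma type1_compress (I I' : set A^o) (C W : lmodType A) (R : ires I C) (R' : ires I' W)
    (x : A) (inc : forall n, {linear imod R' n -> imod R n.+1}) n :
  M x -> (forall n, injective (inc n)) ->
  (forall n e, inc n.+1 (idiff R' n e) = idiff R n.+1 (inc n e)) ->
  (forall n (e : imod R n.+1), x *: e = 0 -> exists k t,
     [/\ x *: t = 0, e = inc n k + idiff R n t &
         forall a, a *: e = 0 -> a *: k = 0 /\ a *: t = 0]) ->
  (forall k t, x *: t = 0 -> inc 0%N k = idiff R 0 t -> k = 0) ->
  type1 R n.+1 -> type1 R' n.
Proof.
move=> Mx incI incd dec cap [e [Me de nb eb]].
have [k [t [xt eE kt]]] := dec n e (Me x Mx).
have Mk : M_killed k by move=> a /Me/kt[].
have Mt : M_killed t by move=> a /Me/kt[].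
have inc_killed m (u : imod R' m) : M_killed u -> M_killed (inc m u).
  by move=> Mu a Ma; rewrite -linearZ Mu // linear0.
exists k; split=> //.
- apply: (incI n.+1); rewrite incd linear0.
  by have := de; rewrite eE linearD ires_dd addr0.
- case: n e k t xt eE kt Mk Mt Me de nb eb => [|n] e k t xt eE kt Mk Mt Me de nb eb /=.
    by move=> k0; apply: nb; exists t => //; rewrite eE k0 linear0 add0r.
  move=> [w Mw wk]; apply: nb; exists (inc n w + t).
    by move=> a Ma; rewrite scalerDr Mt // inc_killed // addr0.
  by rewrite linearD eE -wk incd.
- move=> z Mz dz; have [||a [w Mw wE]] := eb (inc n z).
  + exact: inc_killed.
  + by rewrite -incd dz linear0.
  have wE' : inc n (z - a *: k) = idiff R n (w + a *: t).
    rewrite (linearB (inc n)) (linearD (idiff R n)) wE !linearZ /=.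
    by rewrite eE opprD scalerDr addrA -[RHS]addrA -scalerDr addNr scaler0 addr0.
  have Mw' : M_killed (w + a *: t).
    by move=> b Mb; rewrite scalerDr Mw // scalerA mulrC -scalerA Mt // scaler0 addr0.
  exists a; move: (w + a *: t) wE' Mw' => w' wE' Mw'.
  clear - Mx incI incd dec cap wE' Mw'.
  case: n k z w' wE' Mw' => [|n] k z w' wE' Mw' /=.
    by apply: cap wE'; exact: Mw'.
  have [k' [t' [_ w'E kt']]] := dec n w' (Mw' x Mx).
  exists k'; first by move=> b /Mw'/kt'[].
  by apply: (incI n.+1); rewrite incd wE' w'E linearD ires_dd addr0.
Qed.

End Type1.

(** * Endomorphisms and self-extensions of a canonical module *)

Section Core.
Variables (A : comPzRingType) (M : set A).
Hypotheses (A_noeth : noetherian A) (A_local : local_with_maximal_ideal M).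

(** When [I] kills [C], bijectivity of the map from [A / I] to End(C). *)
Definition homothety_iso (I : set A^o) (C : lmodType A) :=
  (forall u : {linear C -> C}, exists a : A, forall c, u c = a *: c) /\
  (forall a : A, (forall c : C, a *: c = 0) -> I a).

(** Ext^i(C, C) = 0 for i > 0. *)
Definition self_acyclic (I : set A^o) (C : lmodType A) (R : ires I C) :=
  forall i (g : {linear C -> imod R i.+1}), (forall v, idiff R i.+1 (g v) = 0) ->
    exists h : {linear C -> imod R i}, forall v, idiff R i (h v) = g v.

(** Here type one says that the socle of [C] is generated by one nonzero element. *)
Lemma canonical_core_base (I : set A^o) (C : lmodType A) (R R' : ires I C) N :
  submod I -> I `<=` M -> fin_gen C -> dim_le I 0 ->
  (forall i, (N < i)%N -> forall e : imod R i, e = 0) -> type1 M R' 0 ->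
  homothety_iso I C /\ self_acyclic R.
Proof.
move=> hI IM fC dI R_fin [e [Me /iexact0[s0 e_s0] e_neq0 e_gen]].
have I1 : ~ I 1 by move=> /IM; exact: (M_proper A_local).
have s0_neq0 : s0 <> 0 by move=> s00; apply: e_neq0; rewrite /= e_s0 s00 linear0.
have s0_soc a : M a -> a *: s0 = 0.
  move=> Ma; apply: (@iaug_inj _ _ _ R').
  by rewrite linear0 linearZ /= -e_s0 Me.
have s0_gen c : (forall a, M a -> a *: c = 0) -> exists a, c = a *: s0.
  move=> Mc; have [||a ca] := e_gen (iaug R' c).
  - by move=> a Ma; rewrite -linearZ Mc // linear0.
  - exact: ires_da.
  exists a; apply: (@iaug_inj _ _ _ R'); rewrite linearZ /= -e_s0.
  exact/subr0_eq.
have acy := zero_dim_acyclic A_noeth A_local hI I1 dI R_fin.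
split; first split.
- exact: (zero_dim_end A_noeth A_local hI I1 dI R_fin s0_soc s0_gen).
- exact: (zero_dim_faithful A_noeth A_local hI I1 dI R_fin s0_neq0 s0_soc).
- move=> i g dg; apply: acyclic_fin_gen => //; first by move=> J hJ IJ; exact: acy.
  exact: ires_killed.
Qed.

Section Step.
Variables (I : set A^o) (C W : lmodType A) (R : ires I C) (x : A) (q : {linear C -> W}).
Hypotheses (hI : submod I) (Mx : M x) (C_fg : fin_gen C).
Hypotheses (x_regC : forall c : C, x *: c = 0 -> c = 0).
Hypotheses (q_surj : forall w, exists c, w = q c)
  (q_ker : forall c, q c = 0 <-> exists c', c = x *: c').

Lemma q_lift (V : lmodType A) (g : {linear C -> V}) : (forall c, g (x *: c) = 0) ->
  exists h : {linear W -> V}, forall c, h (q c) = g c.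
Proof.
move=> gx; have [|||h hP] := @lin_of_rel A W V (fun w v => exists c, w = q c /\ v = g c).
- by move=> w; have [c ->] := q_surj w; exists (g c), c.
- by move=> a _ _ _ _ [c [-> ->]] [c' [-> ->]]; exists (a *: c + c'); rewrite !linearP.
- by move=> _ [c [/esym/q_ker[c' ->] ->]]; exact: gx.
exists h => c; have [c' [cc' ->]] := hP (q c).
apply/subr0_eq; rewrite -linearB; have /q_ker[c0 ->] : q (c' - c) = 0.
  by rewrite linearB cc' subrr.
exact: gx.
Qed.

(** An endomorphism [u] of [C] induces on C / xC a homothety, say [a]; then u - a is
    x times an endomorphism.  By Nakayama's lemma in End(C), seen as the cocycles of
    degree 0, the homotheties exhaust End(C).  If K is the annihilator of [C], the
    same division by [x] shows that K lies in I + xK, hence in [I]. *)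
Lemma step_homothety_iso : homothety_iso (add_mult I x) W -> homothety_iso I C.
Proof.
move=> [Wend Wfaith].
have CE (g : C -> imod R 0) : @cocycles _ _ _ R C 0 g ->
    exists u : {linear C -> C}, forall c, g c = iaug R (u c).
  move=> [gL dg]; have [|||u uP] := @lin_of_rel A C C (fun c c' => g c = iaug R c').
  - by move=> c; have /iexact0[c' ->] := dg c; exists c'.
  - by move=> a c c' d d' gc gd; rewrite gL gc gd linearP.
  - move=> c gc; apply: (@iaug_inj _ _ _ R); rewrite linear0 -gc.
    by have := linear0 (lin_of gL).
  by exists u.
split.
- pose B : set (C -> imod R 0) := [set g | exists a : A, forall c, g c = a *: iaug R c].
  have hB : submod B.
    split.
    + by exists 0 => c; rewrite scale0r.
    + move=> g h [a ga] [b hb]; exists (a + b) => c.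
      by rewrite addrfctE /= ga hb scalerDl.
    + move=> a g [b gb]; exists (a * b) => c.
      by rewrite scalrfctE /= gb scalerA.
  have N : rel_noeth B (@cocycles _ _ _ R C 0).
    refine (rel_noethW hB _ (@subset_refl _ _) (ext0_noeth (R := R) A_noeth C_fg C_fg)); move=> g g0.
    by exists 0 => c; rewrite g0 scale0r.
  have ZB := nakayama A_noeth A_local hB N (@cocycles_submod _ _ _ R C 0) Mx.
  move=> u; have [||a aP] := ZB _ (fun c => iaug R (u c)); last 1 first.
  + by exists a => c; apply: (@iaug_inj _ _ _ R); rewrite aP linearZ.
  + move=> g /CE[v gv].
    have [|v' v'P] := q_lift (g := lcomp q v).
      by move=> c; rewrite lcompE linearZ; apply/q_ker; exists (v c).
    have [a aP] := Wend v'.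
    have [|||w wP] := @lin_of_rel A C C (fun c c' => v c - a *: c = x *: c').
    * by move=> c; apply/q_ker; rewrite linearB linearZ /= -aP v'P lcompE subrr.
    * move=> b c c' d d' cc' dd'; rewrite linearP scalerDr opprD addrACA dd'.
      rewrite scalerA mulrC -scalerA -scalerBr cc' scalerDr !scalerA.
      by rewrite [b * x]mulrC.
    * by move=> c; rewrite linear0 scaler0 subrr => /esym/x_regC.
    exists (fun c => iaug R (w c)).
      split; last by move=> c; exact: ires_da.
      by move=> b c d; rewrite !linearP.
    exists a => c; rewrite -linearZ.
    rewrite -[LHS]/(g c - x *: iaug R (w c)) gv -linearZ -linearB /= -wP.
    by rewrite opprB addrC subrK.
  + split; last by move=> c; exact: ires_da.
    by move=> b c d; rewrite !linearP.
- pose K : set A^o := [set a : A | forall c : C, a *: c = 0].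
  have hK : submod K.
    split=> [c|a b ha hb c|a b hb c]; first by rewrite scale0r.
      by rewrite scalerDl ha hb addr0.
    by rewrite -[a *: b]/(a * b) -scalerA hb scaler0.
  have N : rel_noeth I K.
    by apply: (rel_noethW hI _ (@subsetT _ K) (noeth_regular A_noeth)) => _ ->; exact: (sm0 hI).
  move=> a aC; apply: (nakayama A_noeth A_local hI N hK Mx) => // b Kb.
  have [p [c [Ip bE]]] : add_mult I x b.
    by apply: Wfaith => w; have [v ->] := q_surj w; rewrite -linearZ Kb linear0.
  exists c; last by rewrite bE addrK.
  move=> v; apply: x_regC; rewrite scalerA.
  have := Kb v; rewrite bE scalerDl => <-.
  have -> : (p : A) *: v = 0 by exact: (ires_killed R).
  by rewrite add0r.
Qed.

(** A cocycle z on [C] is x times some linear g1, by injectivity.  The coboundary of g1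
    is killed by [x], so it comes from a cocycle on C / xC and is the coboundary of
    some h killed by [x].  Then z is x times the cocycle g1 - h, and Nakayama's lemma
    applies to the module of extensions. *)
Lemma step_self_acyclic (R' : ires (add_mult I x) W)
    (inc : forall n, {linear imod R' n -> imod R n.+1}) :
  (forall n, injective (inc n)) ->
  (forall n e, inc n.+1 (idiff R' n e) = idiff R n.+1 (inc n e)) ->
  (forall n e, x *: inc n e = 0) ->
  (forall n (e : imod R n.+2), x *: e = 0 -> exists k, inc n.+1 k = e) ->
  self_acyclic R' -> self_acyclic R.
Proof.
move=> incI incd incx inc_im acy i g dg.
have kC := ires_killed R.
have ZB := nakayama A_noeth A_local (@coboundaries_submod _ _ _ R C i.+1)
   (ext_noeth (R := R) A_noeth hI C_fg C_fg kC) (@cocycles_submod _ _ _ R C i.+1) Mx.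
have [||h hP] := ZB _ (g : C -> imod R i.+1); last by exists h => v; rewrite -hP.
- move=> z [zL dz].
  have [g1 g1P] := inj_over_divhom (lin_of zL) (@imod_inj _ _ _ R i.+1) kC x_regC.
  have xdg1 v : x *: idiff R i.+1 (g1 v) = 0.
    by rewrite -linearZ g1P lin_ofE dz.
  have [|||k kP] := @lin_of_rel A C (imod R' i.+1)
      (fun v k => inc i.+1 k = idiff R i.+1 (g1 v)).
  + by move=> v; exact: inc_im.
  + by move=> a u ku v kv hu hv; rewrite !linearP /= hu hv.
  + by move=> k; rewrite !linear0 => h; apply: (incI i.+1); rewrite h linear0.
  have [|k' k'P] := q_lift (g := k).
    move=> c; apply: (incI i.+1).
    by rewrite kP linear0 !linearZ /= xdg1.
  have [w|h' h'P] := acy i k'.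
    have [v ->] := q_surj w; apply: (incI i.+2).
    by rewrite incd k'P kP ires_dd linear0.
  pose h := lcomp (inc i) (lcomp h' q).
  exists (fun v => lin_comb (-1) h g1 v).
    split; first by move=> a u v; rewrite linearP.
    move=> v; rewrite lin_combE linearP /= -incd h'P k'P kP.
    by rewrite scaleN1r addNr.
  have -> : z - x *: (fun v => lin_comb (-1) h g1 v) = 0; last exact: (sm0 (@coboundaries_submod _ _ _ R C i.+1)).
  apply/funext => v.
  rewrite -[LHS]/(z v - x *: lin_comb (-1) h g1 v) lin_combE scaleN1r scalerDr.
  by rewrite scalerN lcompE incx oppr0 add0r g1P lin_ofE subrr.
- by split=> //; move=> a u v; rewrite linearP.
Qed.

End Step.

(** Two resolutions, because finite injective dimension and type one are each
    witnessed by a resolution of its own, and no comparison between them is made. *)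
Theorem canonical_core n (I : set A^o) (C : lmodType A) (R R' : ires I C) N :
  submod I -> I `<=` M -> fin_gen C -> has_reg_seq M n I -> has_reg_seq M n [set (0 : C)] ->
  dim_le I n -> (forall i, (N < i)%N -> forall e : imod R i, e = 0) ->
  type1 M R' n -> homothety_iso I C /\ self_acyclic R.
Proof.
elim: n I C R R' => [|n IH] I C R R' hI IM fC rsI rsC dI R_fin tR'.
  exact: (canonical_core_base hI IM fC dI R_fin tR').
have nsI : no_socle M I by have [y [My ry _]] := rsI; exact: reg_no_socle My ry.
have nsC : no_socle M [set (0 : C)] by have [y [My ry _]] := rsC; exact: reg_no_socle My ry.
have h0 := @submod0 A C.
have fA := @regular_fin_gen A.
have [x [Mx rI rC]] := common_reg A_noeth A_local fA fC hI h0 nsI nsC.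
pose P := Submodule (add_mult_submod x h0).
pose W : lmodType A := quo P; pose q : {linear C -> W} := qlin P.
have q_surj w : exists c, w = q c by exact: qlin_surj.
have q_ker c : q c = 0 <-> exists c', c = x *: c'.
  rewrite qlin_eq0 /P /=; split=> [[p [c' [-> ->]]]|[c' ->]].
    by exists c'; rewrite add0r.
  exact: add_mult_mul.
have [R1 [inc1 [inc1I inc1d inc1x inc1im _]]] := compress R hI rI rC q_surj q_ker.
have [R1' [inc1' [inc1'I inc1'd _ _ [dec cap]]]] := compress R' hI rI rC q_surj q_ker.
have hI' : submod (add_mult I x) := add_mult_submod x hI.
have [||||||||Wh Wa] := IH (add_mult I x) W R1 R1'.
- exact: hI'.
- move=> _ [p [w [/IM Mp ->]]]; apply: (smD (M_ideal A_local)) => //.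
  by rewrite /GRing.scale /= mulrC; exact: (smZ (M_ideal A_local)).
- exact: quo_fin_gen.
- exact: (reg_seq_exchange A_noeth A_local fA hI Mx rI rsI).
- apply: (@has_reg_seq_preim A M C W q) => //.
  have := reg_seq_exchange A_noeth A_local fC h0 Mx rC rsC.
  by congr (has_reg_seq M n _); apply/seteqP; split=> c /(qlin_eq0 P).
- exact: dim_le_add_mult.
- move=> i Ni e; apply: (inc1I i); rewrite linear0; apply: R_fin; exact: ltnW.
- exact: (type1_compress Mx inc1'I inc1'd dec cap tR').
split; first exact: (step_homothety_iso R hI Mx fC rC q_surj q_ker Wh).
exact: (step_self_acyclic hI Mx fC rC q_surj q_ker inc1I inc1d inc1x inc1im Wa).
Qed.

End Core.

(** * Canonical modules *)

Section Invariants.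
Variable A : comPzRingType.

Lemma quotient_krull_dim_unique (I : set A) d e :
  quotient_krull_dim I d -> quotient_krull_dim I e -> d = e.
Proof.
move=> [[p pP] pmax] [[q qP] qmax]; apply/eqP.
by rewrite eqn_leq (qmax _ _ pP) (pmax _ _ qP).
Qed.

Lemma depth_unique (M : set A) (V : lmodType A) s t : depth M V s -> depth M V t -> s = t.
Proof.
move=> [[x [xs xM xr]] xmax] [[y [yt yM yr]] ymax]; apply/eqP.
by rewrite eqn_leq -{1}xs -{2}yt (ymax _ xM xr) (xmax _ yM yr).
Qed.

Lemma depth_reg_seq (M : set A) (V : lmodType A) t : depth M V t -> has_reg_seq M t [set (0 : V)].
Proof. by move=> [[s [<- sM sr]] _]; exact: regular_sequence_has_reg_seq. Qed.

Lemma annihilator_regular : annihilator (A^o : lmodType A) = [set 0].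
Proof.
apply/seteqP; split=> [a /(_ 1)|_ -> x]; last exact: scale0r.
by rewrite /GRing.scale /= mulr1.
Qed.

Lemma inj_over0 (E : lmodType A) : injective_module E -> inj_over [set 0] E.
Proof. by move=> hE X Y i g _; exact: hE. Qed.

Definition ires_of (C : lmodType A) (E : injective_resolution C) : ires [set 0] C.
Proof.
refine (@IRes A [set 0] C (res_mod E) (@res_diff _ _ E) (res_aug E) _ _ _ _ _).
- by move=> n; apply: inj_over0; exact: res_injective.
- by move=> n a v ->; exact: scale0r.
- exact: res_aug_inj.
- exact: res_exact0.
- exact: res_exactS.
Defined.

(** A linear map out of the residue module is determined by the image of the class
    of 1, an arbitrary element killed by [M]. *)
Lemma type1_of_ext (M : set A) (W : lmodType A) n : ~ M 1 ->
  ext_residue_dim M W n 1 -> exists R : ires [set 0] W, type1 M R n.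
Proof.
move=> M1 [k [[p [p_surj p_ker]] [E [e [e_coc e_span e_free]]]]].
have k_lift (V : lmodType A) (v : V) : M_killed M v ->
    exists h : {linear k -> V}, forall a : A, h (p a) = a *: v.
  move=> Mv; have [|||h hP] := @lin_of_rel A k V (fun y w => exists a : A, y = p a /\ w = a *: v).
  - by move=> y; have [a ->] := p_surj y; exists ((a : A) *: v), a.
  - move=> b _ _ _ _ [a [-> ->]] [a' [-> ->]]; exists (b * a + a').
    by rewrite -linearP scalerDl scalerA.
  - by move=> _ [a [/esym/p_ker/Mv + ->]].
  exists h => a; have [b [ab ->]] := hP (p a).
  by apply/subr0_eq; rewrite -scalerBl; apply: Mv; apply/p_ker; rewrite linearB ab subrr.
have pM a : M a -> a *: p 1 = 0.
  by move=> Ma; rewrite -linearZ; apply/p_ker; rewrite /GRing.scale /= mulr1.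
have pE (a : A^o) : p a = (a : A) *: p 1 by rewrite -linearZ /GRing.scale /= mulr1.
have gM (V : lmodType A) (g : {linear k -> V}) : M_killed M (g (p 1)).
  by move=> a Ma; rewrite -linearZ pM // linear0.
exists (ires_of E); have [eL de] := e_coc ord0.
have cobP (g : k -> res_mod E n) : linear g ->
    ext_coboundary g <-> M_coboundary M (R := ires_of E) (g (p 1)).
  move=> gL; have gZ (a : A) y : g (a *: y) = a *: g y by exact: (linearZ_LR (lin_of gL)).
  case: n {e e_coc e_span e_free eL de} g gL gZ => [|n] g gL gZ /=.
    split=> [->//|g0 y].
    by have [a ->] := p_surj y; rewrite pE gZ g0 scaler0.
  split=> [[h hP]|[w Mw wP]].
    by exists (h (p 1)); [exact: gM|rewrite hP].
  have [h hP] := k_lift _ w Mw; exists h => y; have [a ->] := p_surj y.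
  by rewrite hP linearZ /= wP pE gZ.
exists (e ord0 (p 1)); split.
- exact: (gM _ (lin_of eL)).
- exact: de.
- move=> /(cobP _ eL) ec; apply: M1; apply: (e_free (fun=> 1) _ ord0).
  by move: ec; congr ext_coboundary; apply/funext => x; rewrite big_ord1 scale1r.
- move=> z Mz dz; have [h hP] := k_lift _ z Mz.
  have [|a aP] := e_span h.
    split; first exact: linearP.
    by move=> y; have [b ->] := p_surj y; rewrite hP linearZ /= dz scaler0.
  exists (a ord0); have -> : z - a ord0 *: e ord0 (p 1) = h (p 1) - \sum_(j < 1) a j *: e j (p 1).
    by rewrite big_ord1 hP scale1r.
  apply/(cobP (fun x => h x - \sum_(j < 1) a j *: e j x)) => //.
  move=> b u v; rewrite !big_ord1 linearP eL scalerDr opprD addrACA scalerBr !scalerA.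
  by rewrite [b * a _]mulrC.
Qed.

(** The depths of [A] and [W] agree because both are equal to the dimension of [A]. *)
Lemma canonical_homothety (M : set A) (W : lmodType A) :
  noetherian A -> local_with_maximal_ideal M -> cohen_macaulay_ring M ->
  canonical_module M W ->
  homothety_iso [set 0] W /\
  exists E : injective_resolution W, (exists n, forall i, (n < i)%N -> forall x : res_mod E i, x = 0) /\
    self_acyclic (ires_of E).
Proof.
move=> A_noeth A_local [_ _ [d [depA dimA]]] [[[W_fg _ [t [depW dimW]]] [t' [dimW' dimA']]] [t'' [depW' extW]] [E [N E_fin]]].
have td : t = d.
  rewrite (quotient_krull_dim_unique dimW dimW').
  by apply: (quotient_krull_dim_unique dimA'); rewrite -annihilator_regular.
have t''d : t'' = d by rewrite -td; exact: depth_unique depW' depW.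
rewrite {}td in depW; rewrite {}t''d in extW.
have [R' tR'] := type1_of_ext (M_proper A_local) extW.
have [||||||||hW aW] := canonical_core A_noeth A_local (R := ires_of E) (R' := R') (n := d) (N := N).
- exact: submod0.
- by move=> _ ->; exact: (sm0 (M_ideal A_local)).
- exact: W_fg.
- exact: depth_reg_seq depA.
- exact: depth_reg_seq depW.
- by move=> m p; rewrite -annihilator_regular; case: dimA => _; apply.
- exact: E_fin.
- exact: tR'.
by split=> //; exists E; split=> //; exists N.
Qed.

End Invariants.

(** * Coinduction along a ring homomorphism *)

Section Coinduction.
Variables A S : comPzRingType.

(** Restriction of scalars; [phi] is an argument because it determines the scaling. *)
Definition restr (phi : {rmorphism A -> S}) (X : lmodType S) : Type := X.

Variable phi : {rmorphism A -> S}.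

Section Restriction.
Variable X : lmodType S.
HB.instance Definition _ := GRing.Zmodule.copy (restr phi X) X.

Definition restr_scale (a : A) (x : restr phi X) : restr phi X := phi a *: (x : X).
Fact restr_scaleA a b x : restr_scale a (restr_scale b x) = restr_scale (a * b) x.
Proof. by rewrite /restr_scale scalerA rmorphM. Qed.
Fact restr_scale1 : left_id 1 restr_scale.
Proof. by move=> x; rewrite /restr_scale rmorph1 scale1r. Qed.
Fact restr_scaleDr : right_distributive restr_scale +%R.
Proof. by move=> a x y; rewrite /restr_scale scalerDr. Qed.
Fact restr_scaleDl x : {morph restr_scale^~ x : a b / a + b}.
Proof. by move=> a b; rewrite /restr_scale rmorphD scalerDl. Qed.
HB.instance Definition _ := GRing.Zmodule_isLmodule.Build A (restr phi X)
  restr_scaleA restr_scale1 restr_scaleDr restr_scaleDl.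

Lemma restr_scaleE (a : A) (x : restr phi X) : a *: x = phi a *: (x : X).
Proof. by []. Qed.
End Restriction.

Section Coind.
Variable E : lmodType A.

Fact coind_submod :
  submod [set h : S -> E | forall a s s', h (phi a * s + s') = a *: h s + h s'].
Proof.
split=> /=.
- by move=> a s s'; rewrite scaler0 addr0.
- by move=> g h hg hh a s s'; rewrite addrfctE hg hh scalerDr addrACA.
- by move=> b g hg a s s'; rewrite scalrfctE hg scalerDr !scalerA mulrC.
Qed.

(** Hom_A(S, E), on which [S] acts through its multiplication. *)
Definition coind : Type := sm_type (Submodule coind_submod).
HB.instance Definition _ := GRing.Zmodule.copy coind (sm_type (Submodule coind_submod)).

Definition cval (h : coind) : S -> E := sm_val h.

Lemma cvalP (h : coind) a s s' : cval h (phi a * s + s') = a *: cval h s + cval h s'.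
Proof. exact: (sm_valP h). Qed.

Definition coind_of (h : S -> E)
    (hP : forall a s s', h (phi a * s + s') = a *: h s + h s') : coind :=
  @sm_in A _ (Submodule coind_submod) h hP.

Lemma coindP (g h : coind) : (forall s, cval g s = cval h s) -> g = h.
Proof. by move=> gh; apply: sm_val_inj; apply/funext. Qed.

Lemma cvalD (g h : coind) s : cval (g + h) s = cval g s + cval h s. Proof. by []. Qed.

Lemma cval0 s : cval 0 s = 0. Proof. by []. Qed.

Lemma cval_at0 (h : coind) : cval h 0 = 0.
Proof. by have := cvalP h (-1) 0 0; rewrite mulr0 addr0 scaleN1r addNr. Qed.

Fact coind_scale_subproof (r : S) (h : coind) a s s' :
  cval h ((phi a * s + s') * r) = a *: cval h (s * r) + cval h (s' * r).
Proof. by rewrite mulrDl -mulrA cvalP. Qed.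

Definition coind_scale r h := coind_of (coind_scale_subproof r h).

Fact coind_scaleA a b x : coind_scale a (coind_scale b x) = coind_scale (a * b) x.
Proof. by apply: coindP => s; rewrite /cval /= -mulrA. Qed.
Fact coind_scale1 : left_id 1 coind_scale.
Proof. by move=> x; apply: coindP => s; rewrite /cval /= mulr1. Qed.
Fact coind_scaleDr : right_distributive coind_scale +%R.
Proof. by move=> a x y; apply: coindP. Qed.
Fact coind_scaleDl x : {morph coind_scale^~ x : a b / a + b}.
Proof.
move=> a b; apply: coindP => s; rewrite cvalD /cval /= mulrDr.
by have := cvalP x 1 (s * a) (s * b); rewrite rmorph1 mul1r scale1r.
Qed.
HB.instance Definition _ := GRing.Zmodule_isLmodule.Build S coind
  coind_scaleA coind_scale1 coind_scaleDr coind_scaleDl.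

Lemma cvalZ (r : S) (h : coind) s : cval (r *: h) s = cval h (s * r). Proof. by []. Qed.

(** By evaluation at 1, the [S]-linear maps from [X] to Hom_A(S, E) correspond to the
    [A]-linear maps from [X] to [E]. *)
Lemma coind_injective : injective_module E -> injective_module (coind : lmodType S).
Proof.
move=> hE X Y i g i_inj.
have iL : linear (i : restr phi X -> restr phi Y).
  by move=> a u v; rewrite !restr_scaleE; exact: (linearP i).
have gL : linear (fun x : restr phi X => cval (g x) 1).
  move=> a u v; rewrite restr_scaleE.
  have -> : g (phi a *: (u : X) + v) = phi a *: g u + g v by exact: (linearP g).
  rewrite cvalD cvalZ mul1r; congr (_ + _).
  by have := cvalP (g u) a 1 0; rewrite mulr1 !addr0 cval_at0 addr0.
have [h hP] := hE _ _ (lin_of iL) (lin_of gL) i_inj.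
have hSP y a s s' : h ((phi a * s + s') *: (y : Y)) = a *: h (s *: y) + h (s' *: y).
  by rewrite scalerDl -scalerA -linearP.
have HL : linear (fun y : Y => coind_of (hSP y) : (coind : lmodType S)).
  move=> r u v; apply: coindP => s; rewrite cvalD cvalZ /cval /= scalerDr scalerA.
  exact: linearD.
exists (lin_of HL) => x; apply: coindP => s; rewrite lin_ofE /cval /=.
rewrite -linearZ /=; have := hP (s *: x); rewrite /= => ->.
by rewrite (linearZ_LR g) cvalZ mul1r.
Qed.

End Coind.
End Coinduction.

(** * The Jacobson radical *)

Section MaximalIdeals.
Variable B : comPzRingType.

(** Zorn's lemma; the empty set is admitted as an upper bound of the empty chain. *)
Lemma maximal_ideal_over (I : set B) : is_ideal I -> ~ I 1 ->
  exists2 N, maximal_ideal N & I `<=` N.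
Proof.
move=> hI I1.
pose P (X : set B) := X = set0 \/ [/\ is_ideal X, ~ X 1 & I `<=` X].
have [F FP Ftot|N [NP Nmax]] := @Zorn_bigcup B P.
  have [[X FX X0]|nX] := pselect (exists2 X, F X & X !=set0); last first.
    by left; rewrite -subset0 => x [X FX Xx]; apply: nX; exists X => //; exists x.
  have FI Y : F Y -> Y !=set0 -> [/\ is_ideal Y, ~ Y 1 & I `<=` Y].
    by move=> /FP[-> [y []]|].
  have [[X0' _ _] _ IX] := FI X FX X0.
  right; split.
  - split; first by exists X.
      move=> x y [Y FY Yx] [Z FZ Zy].
      have [YZ|ZY] := Ftot _ _ FY FZ.
        exists Z => //; have [[_ + _] _ _] := FI Z FZ (ex_intro _ y Zy).
        by apply=> //; exact: YZ.
      exists Y => //; have [[_ + _] _ _] := FI Y FY (ex_intro _ x Yx).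
      by apply=> //; exact: ZY.
    move=> a x [Y FY Yx]; exists Y => //.
    by have [[_ _ h] _ _] := FI Y FY (ex_intro _ x Yx); exact: h.
  - by move=> [Y FY Y1]; have [_ + _] := FI Y FY (ex_intro _ 1 Y1); apply.
  - by move=> x Ix; exists X => //; exact: IX.
have [N0|[hN N1 IN]] := NP.
  exfalso; apply: (Nmax I); last by right; split.
  rewrite N0; split=> // h; have [I0 _ _] := hI; exact: (h 0 I0).
exists N => //; split=> // K hK NK.
have [K1|K1] := pselect (K 1).
  by right; apply/seteqP; split=> // x _; rewrite -(mulr1 x); case: hK => _ _; apply.
left; apply: contrapT => KN; apply: (Nmax K).
  by split=> // h; apply: KN; apply/seteqP; split.
by right; split=> // x /IN/NK.
Qed.

Lemma jacobson_unit (j : B) : jacobson_radical B j -> exists e, e * (1 + j) = 1.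
Proof.
move=> Jj; apply: contrapT => ne.
have [||N Nmax jN] := @maximal_ideal_over [set x | exists b, x = b * (1 + j)].
- split; first by exists 0; rewrite mul0r.
    by move=> _ _ [b ->] [c ->]; exists (b + c); rewrite mulrDl.
  by move=> a _ [b ->]; exists (a * b); rewrite mulrA.
- by move=> [b /esym h]; apply: ne; exists b.
have [[_ ND NM] N1 _] := Nmax; apply: N1.
have -> : 1 = (1 + j) + (-1) * j by rewrite mulN1r addrK.
apply: ND; first by apply: jN; exists 1; rewrite mul1r.
by apply: NM; exact: Jj.
Qed.

End MaximalIdeals.

(** * The amalgamation *)

Section Amalgamation.
Variables (A B : comPzRingType) (f : {rmorphism A -> B}) (J : ideal B).
Local Notation S := (amalgamation f J).
Local Notation JA := (ideal_via f J).

Definition proj1_amalg (s : S) : A := (amalg_val s).1.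

Fact embA_subproof a : (a, f a) \in amalg_pred f J.
Proof.
apply/mem_set; exists a, 0; rewrite addr0; split=> //.
by have [J0 _ _] := ideal_setP J.
Qed.
Definition embA (a : A) : S := Amalgamation (embA_subproof a).

Fact embJ_subproof (k : JA) : (0, val k) \in amalg_pred f J.
Proof.
apply/mem_set; exists 0, (val k); rewrite rmorph0 add0r; split=> //.
exact: set_mem (valP k).
Qed.
Definition embJ (k : JA) : S := Amalgamation (embJ_subproof k).

Fact projJ_subproof (s : S) : (amalg_val s).2 - f (amalg_val s).1 \in ideal_pred J.
Proof.
case: s => x /= /set_mem[a [j [Jj ->]]] /=.
by rewrite addrC addKr; apply/mem_set.
Qed.
Definition projJ (s : S) : JA := IdealVia f (projJ_subproof s).

Fact embA_zmod : zmod_morphism embA.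
Proof. by move=> a b; apply: val_inj; rewrite /= rmorphB. Qed.
Fact embA_monoid : monoid_morphism embA.
Proof.
split; first by apply: val_inj; rewrite /= rmorph1.
by move=> a b; apply: val_inj; rewrite /= rmorphM.
Qed.
HB.instance Definition _ := GRing.isZmodMorphism.Build A S embA embA_zmod.
HB.instance Definition _ := GRing.isMonoidMorphism.Build A S embA embA_monoid.
Definition iotaA : {rmorphism A -> S} := embA.

Lemma valJ (s : S) : val (projJ s) = (amalg_val s).2 - f (amalg_val s).1.
Proof. by []. Qed.

Lemma amalg_ext (s t : S) : proj1_amalg s = proj1_amalg t -> projJ s = projJ t -> s = t.
Proof.
move=> st1 /(congr1 val); rewrite !valJ -/(proj1_amalg s) -/(proj1_amalg t) st1.
move=> /addIr st2; apply: val_inj.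
by rewrite [LHS]surjective_pairing [RHS]surjective_pairing /= st2; congr pair.
Qed.

Lemma proj1_lin a (s t : S) : proj1_amalg (iotaA a * s + t) = a * proj1_amalg s + proj1_amalg t.
Proof. by []. Qed.

Lemma projJ_lin a (s t : S) : projJ (iotaA a * s + t) = a *: projJ s + projJ t.
Proof.
apply: val_inj; rewrite /= rmorphD rmorphM mulrBr opprD addrACA.
by [].
Qed.

Lemma projJ_embA a : projJ (iotaA a) = 0.
Proof. by apply: val_inj; rewrite /= subrr. Qed.
Lemma proj1_embJ k : proj1_amalg (embJ k) = 0. Proof. by []. Qed.
Lemma projJ_embJ k : projJ (embJ k) = k.
Proof. by apply: val_inj; rewrite /= rmorph0 subr0. Qed.

Lemma amalg_decomp (s : S) : s = iotaA (proj1_amalg s) * 1 + embJ (projJ s).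
Proof.
apply: amalg_ext; first by rewrite proj1_lin proj1_embJ addr0 [RHS]mulr1.
rewrite projJ_lin projJ_embJ [projJ 1](_ : _ = 0) ?scaler0 ?add0r //.
by rewrite -(rmorph1 iotaA) projJ_embA.
Qed.

Lemma embJ_lin a (k l : JA) : embJ (a *: k + l) = iotaA a * embJ k + embJ l.
Proof.
apply: amalg_ext; first by rewrite proj1_lin !proj1_embJ mulr0 addr0.
by rewrite projJ_lin !projJ_embJ.
Qed.

Lemma val_projJM (s t : S) : val (projJ (s * t)) =
  f (proj1_amalg s) * val (projJ t) + f (proj1_amalg t) * val (projJ s)
  + val (projJ s) * val (projJ t).
Proof.
rewrite !valJ /proj1_amalg /= rmorphM.
move: (amalg_val s).2 (amalg_val t).2 (f (amalg_val s).1) (f (amalg_val t).1) => a b c e.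
rewrite mulrBr mulrBr mulrBl mulrBr mulrBr [e * c]mulrC [e * a]mulrC.
by rewrite [RHS]addrC addrA subrK addrA subrK.
Qed.

Lemma fin_gen_image (U V : lmodType A) (p : {linear U -> V}) :
  (forall v, exists u, v = p u) -> fin_gen U -> fin_gen V.
Proof.
move=> ps [n [g gP]]; exists n, (fun i => p (g i)) => v.
have [u ->] := ps v; have [c ->] := gP u; exists c.
by rewrite linear_sum; apply: eq_bigr => i _; rewrite linearZ.
Qed.

Lemma amalg_fin_gen : fin_gen JA -> fin_gen (restr iotaA (S^o : lmodType S)).
Proof.
move=> fJ.
have pL : linear (fun u : (A^o * JA)%type =>
    iotaA u.1 * 1 + embJ u.2 : restr iotaA (S^o : lmodType S)).
  move=> a [b k] [c l]; rewrite restr_scaleE /= embJ_lin.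
  rewrite -[a *: b]/(a * b) rmorphD rmorphM -[iotaA a *: _]/(iotaA a * (iotaA b * 1 + embJ k)).
  by rewrite !mulr1 mulrDr addrACA.
apply: (fin_gen_image (p := lin_of pL)).
  by move=> s; exists (proj1_amalg s, projJ s); exact: amalg_decomp.
exact: fin_gen_prod (@regular_fin_gen A) fJ.
Qed.

Lemma amalg_noetherian : noetherian A -> fin_gen JA -> noetherian S.
Proof.
move=> A_noeth fJ I hI.
have N := fin_gen_noeth A_noeth (amalg_fin_gen fJ).
have [I0 ID IM] := hI.
have hI' : submod (I : set (restr iotaA (S^o : lmodType S))).
  by split=> // a x Ix; rewrite restr_scaleE; exact: IM.
have [s [sI Is]] := N I hI' (@subsetT _ _).
exists (size s), (fun i => s`_i); apply/seteqP; split=> x; last first.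
  move=> [c ->]; elim/big_ind: _ => // i _; apply: IM; apply: sI; exact: mem_nth.
move=> /Is; elim: s x {sI Is} => [|g s IH] x /=.
  by move=> ->; exists (fun=> 0); rewrite big_ord0.
move=> [a [y [/IH[c ->] ->]]].
exists (fun i => if unlift ord0 i is Some j then c j else iotaA a).
rewrite big_ord_recl unlift_none; congr (_ + _).
by apply: eq_bigr => i _; rewrite liftK.
Qed.

(** Up to a unit of [A] the element is 1 + k with k in [J]; the inverse e of 1 + k in
    [B] lies in 1 + [J], because e = 1 - e k. *)
Lemma amalg_unit (M : set A) : noetherian A -> local_with_maximal_ideal M ->
  J `<=` jacobson_radical B ->
  forall s : S, ~ M (proj1_amalg s) -> exists t, t * s = 1.
Proof.
move=> A_noeth A_local Jrad s /(unit_notM A_noeth A_local)[b b1].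
pose k := projJ (iotaA b * s).
have sE : iotaA b * s = 1 + embJ k.
  apply: amalg_ext; first by rewrite /= /proj1_amalg /= addr0.
  rewrite -[1 + _](mul1r (1 + _)) mul1r -[1](rmorph1 iotaA) -[iotaA 1]mulr1 projJ_lin.
  by rewrite -(rmorph1 iotaA) projJ_embA scaler0 add0r projJ_embJ.
have [e e1] := jacobson_unit (Jrad _ (set_mem (valP k))).
have [J0 JD JM] := ideal_setP J.
have lJ : - e * val k \in ideal_pred J.
  by apply/mem_set; apply: JM; exact: set_mem (valP k).
pose l : JA := IdealVia f lJ.
exists ((1 + embJ l) * iotaA b); rewrite -mulrA sE; apply: val_inj.
rewrite /= [LHS]surjective_pairing; congr pair; rewrite /= ?addr0 ?mulr1 //.
have -> : 1 + - e * val k = e by rewrite mulNr -{1}e1 mulrDr mulr1 addrK.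
exact: e1.
Qed.

Lemma amalg_local (M : set A) : noetherian A -> local_with_maximal_ideal M ->
  J `<=` jacobson_radical B ->
  local_with_maximal_ideal [set s : S | M (proj1_amalg s)].
Proof.
move=> A_noeth A_local Jrad.
have unitS := amalg_unit A_noeth A_local Jrad.
have hM := M_ideal A_local.
have unit_full (I : set S) s : is_ideal I -> I s -> ~ M (proj1_amalg s) -> I 1.
  by move=> [_ _ IM] Is /unitS[t <-]; exact: IM.
have hMS : is_ideal [set s : S | M (proj1_amalg s)].
  split; first exact: (sm0 hM).
    by move=> x y; exact: (smD hM).
  by move=> a x; exact: (smZ hM).
have full (I : set S) : is_ideal I -> I 1 -> I = setT.
  move=> [_ _ IM] I1; apply/seteqP; split=> // x _.
  by rewrite -(mulr1 x); exact: IM.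
split.
  split=> //; first exact: (M_proper A_local).
  move=> I hI MI; have [IM|nIM] := pselect (I `<=` [set s : S | M (proj1_amalg s)]).
    by left; apply/seteqP; split.
  right; apply: full => //; apply: contrapT => I1; apply: nIM => s Is.
  by apply: contrapT => Ms; apply: I1; exact: unit_full Is Ms.
move=> N [hN N1 Nmax].
have NM : N `<=` [set s : S | M (proj1_amalg s)].
  by move=> s Ns; apply: contrapT => Ms; apply: N1; exact: unit_full Ns Ms.
have [//|MT] := Nmax _ hMS NM.
exfalso; apply: (M_proper A_local).
by have : [set s : S | M (proj1_amalg s)] 1 by rewrite MT.
Qed.

Section GorensteinResolution.
Variables (W : lmodType A) (E : injective_resolution W) (theta : {linear W -> JA}).
Hypotheses (theta_bij : bijective theta) (W_iso : homothety_iso [set 0] W)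
  (W_acyclic : self_acyclic (ires_of E)).

Lemma theta_inv : exists eta : {linear JA -> W},
  (forall w, eta (theta w) = w) /\ (forall k, theta (eta k) = k).
Proof.
have [eta etaK thetaK] := theta_bij.
have etaL : linear eta.
  by move=> a k l; apply: (bij_inj theta_bij); rewrite linearP !thetaK.
by exists (lin_of etaL).
Qed.

Lemma JA_homothety (u : {linear JA -> JA}) : exists a : A, forall k, u k = a *: k.
Proof.
have [eta [etaK thetaK]] := theta_inv.
have [a aP] := W_iso.1 (lcomp eta (lcomp u theta)).
exists a => k; have := aP (eta k); rewrite !lcompE thetaK => /(congr1 theta).
by rewrite linearZ /= !thetaK.
Qed.

Lemma JA_faithful (a : A) : (forall k : JA, a *: k = 0) -> a = 0.
Proof.
move=> ak; apply: W_iso.2 => w; apply: (bij_inj theta_bij).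
by rewrite linearZ /= ak linear0.
Qed.

Variable eta : {linear JA -> W}.
Hypotheses (etaK : forall w, eta (theta w) = w) (thetaK : forall k, theta (eta k) = k).

(** With j0 = v(1), the endomorphisms [k |-> v k] and [k |-> k * j0] of [J] are
    homotheties, of ratios c and a'; the element c - a' + j0 then represents [v]. *)
Lemma self_duality (v : S -> JA) :
  (forall a s t, v (iotaA a * s + t) = a *: v s + v t) ->
  exists r : S, forall s, v s = projJ (s * r).
Proof.
move=> vL; pose j0 := v 1.
have v0 : v 0 = 0 by have := vL (-1) 0 0; rewrite mulr0 addr0 scaleN1r addNr.
have uL : linear (fun k => v (embJ k)) by move=> a k l; rewrite embJ_lin vL.
have [c cP] := JA_homothety (lin_of uL).
pose m (k : JA) := projJ (embJ k * embJ j0).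
have mE k : val (m k) = val k * val j0.
  by rewrite val_projJM !proj1_embJ rmorph0 !mul0r !add0r !projJ_embJ.
have mL : linear m.
  move=> a k l; apply: val_inj; rewrite mE.
  have -> : val (a *: m k + m l) = f a * val (m k) + val (m l) by [].
  by rewrite !mE /= mulrDl -mulrA.
have [a' a'P] := JA_homothety (lin_of mL).
pose r : S := iotaA (c - a') * 1 + embJ j0.
have p1 : projJ 1 = 0 by rewrite -(rmorph1 iotaA) projJ_embA.
have r1 : proj1_amalg r = c - a'.
  by rewrite /r proj1_lin proj1_embJ addr0 [LHS]mulr1.
have rJ : projJ r = j0 by rewrite /r projJ_lin projJ_embJ p1 scaler0 add0r.
exists r => s; apply: val_inj; rewrite val_projJM r1 rJ -mE.
rewrite {1}(amalg_decomp s) vL -[v (embJ _)]/(lin_of uL (projJ s)) cP.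
rewrite -[m _]/(lin_of mL (projJ s)) a'P /=.
by rewrite -addrA -mulrDl -rmorphD subrK.
Qed.

(** The map [r |-> (s |-> pi (s * r))], with the module [W] in the place of [J]. *)
Definition gaug_fun (r s : S) : res_mod E 0 := res_aug E (eta (projJ (s * r))).

Fact gaug_subproof r a s t :
  gaug_fun r (iotaA a * s + t) = a *: gaug_fun r s + gaug_fun r t.
Proof. by rewrite /gaug_fun mulrDl -mulrA projJ_lin !linearP. Qed.

Definition gaug r : coind iotaA (res_mod E 0) := coind_of (gaug_subproof r).

Fact gaug_linear : linear (gaug : (S^o : lmodType S) -> (coind iotaA (res_mod E 0) : lmodType S)).
Proof.
move=> r x y; apply: coindP => s; rewrite cvalD cvalZ /cval /= /gaug_fun.
rewrite -linearD -linearD; congr (res_aug E (eta _)).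
have := projJ_lin 1 (s * (r * x)) (s * y); rewrite rmorph1 mul1r scale1r mulrA => <-.
by rewrite mulrDr mulrA.
Qed.

Fact gdiff_subproof n (h : coind iotaA (res_mod E n)) a s t :
  res_diff E n (cval h (iotaA a * s + t)) = a *: res_diff E n (cval h s) + res_diff E n (cval h t).
Proof. by rewrite cvalP linearP. Qed.

Definition gdiff n h : coind iotaA (res_mod E n.+1) := coind_of (@gdiff_subproof n h).

Fact gdiff_linear n : linear (@gdiff n : (coind iotaA (res_mod E n) : lmodType S) -> (coind iotaA (res_mod E n.+1) : lmodType S)).
Proof.
move=> r x y; apply: coindP => s; rewrite cvalD cvalZ /cval /=.
by rewrite -linearD.
Qed.

(** Exactness in degree 0 is [self_duality].  In positive degrees a cocycle on [R] has
    a primitive on the summand [A], which is free, and one on the summand [J], whose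
    higher self-extensions vanish. *)
Definition gorenstein_resolution : injective_resolution (S^o : lmodType S).
Proof.
refine (@InjectiveResolution S (S^o : lmodType S) (fun n => coind iotaA (res_mod E n))
  (fun n => lin_of (@gdiff_linear n)) (lin_of gaug_linear) _ _ _ _).
- by move=> n; apply: coind_injective; exact: res_injective.
- move=> x y xy; apply/subr0_eq; set r : S := x - y.
  have r0 s : projJ (s * r) = 0.
    have : gaug r = 0 by rewrite -[gaug r]/(lin_of gaug_linear (x - y)) linearB xy subrr.
    move=> /(congr1 (fun h => cval h s)); rewrite cval0 => h0.
    rewrite -[LHS]thetaK; have -> : eta (projJ (s * r)) = 0; last exact: linear0.
    by apply: (@res_aug_inj _ _ E); rewrite linear0; exact: h0.
  have rJ : projJ r = 0 by rewrite -[r]mul1r r0.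
  have r1 : proj1_amalg r = 0.
    apply: JA_faithful => k; apply: val_inj.
    have := congr1 val (r0 (embJ k)); rewrite val_projJM rJ proj1_embJ projJ_embJ.
    by rewrite rmorph0 mul0r add0r mulr0 addr0.
  apply: amalg_ext; first by rewrite r1.
  by rewrite rJ; apply: val_inj; rewrite /= rmorph0 subrr.
- move=> g; split=> [dg|[r ->]]; last first.
    by apply: coindP => s; apply/res_exact0; exists (eta (projJ (s * r))).
  have gW s : exists w, cval g s = res_aug E w.
    apply/res_exact0; exact: (congr1 (fun h => cval h s) dg).
  have [w wP] := choice gW.
  have [|r rP] := @self_duality (fun s => theta (w s)).
    move=> a s t; rewrite -linearP; congr (theta _).
    by apply: (@res_aug_inj _ _ E); rewrite -wP linearP -!wP cvalP.
  exists r; apply: coindP => s.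
  by rewrite wP -[w s]etaK rP.
- move=> n g; split=> [dg|[h ->]]; last first.
    by apply: coindP => s; apply/res_exactS; exists (cval h s).
  have dgs s : res_diff E n.+1 (cval g s) = 0 by exact: (congr1 (fun h => cval h s) dg).
  have /res_exactS[w wP] := dgs 1.
  have gL : linear (fun x : W => cval g (embJ (theta x))).
    by move=> a x y; rewrite linearP embJ_lin cvalP.
  have [|h hP] := @W_acyclic n (lin_of gL); first by move=> x; exact: dgs.
  have HP a s t : proj1_amalg (iotaA a * s + t) *: w + h (eta (projJ (iotaA a * s + t))) =
      a *: (proj1_amalg s *: w + h (eta (projJ s))) + (proj1_amalg t *: w + h (eta (projJ t))).
    by rewrite proj1_lin projJ_lin (linearP eta) (linearP h) scalerDl -scalerA scalerDr addrACA.
  exists (coind_of HP); apply: coindP => s.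
  rewrite {1}(amalg_decomp s) cvalP wP /cval /= linearD; congr (_ + _).
    by rewrite linearZ.
  have := hP (eta (projJ s)); rewrite /= thetaK => ->.
  by [].
Defined.

End GorensteinResolution.
End Amalgamation.

Theorem mainTheorem9 (A B : comPzRingType) (f : {rmorphism A -> B})
    (M : set A) (J : ideal B)
    (A_noetherian : noetherian A)
    (A_local : local_with_maximal_ideal M)
    (J_jacobson : J `<=` jacobson_radical B)
    (J_fin_gen : fin_gen (ideal_via f J))
    (A_CM : cohen_macaulay_ring M)
    (J_canonical : exists W : lmodType A,
       canonical_module M W /\ lmod_isomorphic W (ideal_via f J)) :
  gorenstein_local_ring (amalgamation f J).
Proof.
have [W [W_can [theta theta_bij]]] := J_canonical.
have [hW [E [[N E_fin] aW]]] := canonical_homothety A_noetherian A_local A_CM W_can.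
split.
- exact: amalg_noetherian.
- by exists [set s : amalgamation f J | M (proj1_amalg s)]; exact: amalg_local.
have [eta [etaK thetaK]] := theta_inv theta_bij.
exists (gorenstein_resolution theta_bij hW aW etaK thetaK), N => i Ni g.
by apply: coindP => s; exact: E_fin.
Qed.
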